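(* Let $F$ be a complete holomorphic vector field on $\mathbb{C}^n$ with a globally attracting fixed point at the origin. Let $\Omega\subseteq\mathbb{C}^n$ be a domain that contains the origin and is invariant under the positive time flows of $F$. Then $\Omega$ is a Runge domain.
   Context: A holomorphic vector field on $\mathbb{C}^n$ is identified with a holomorphic map $F:\mathbb{C}^n\to\mathbb{C}^n$; its flow $X(t,z)$ is the solution of $\frac{d}{dt}X(t,z)=F(X(t,z))$, $X(0,z)=z$. $F$ is complete if $X(t,z)$ exists for all $t\in\mathbb{R}$ and all $z\in\mathbb{C}^n$ (for holomorphic vector fields on $\mathbb{C}^n$ this is equivalent to the flow existing for all complex times). The origin is a globally attracting fixed point of $F$ if $F(0)=0$; for every $\epsilon>0$ there is $\delta>0$ such that $X(t,z)\in B(0,\epsilon)$ for all $z\in B(0,\delta)$ and all $t\ge 0$; and $\lim_{t\to\infty}X(t,z)=0$ for every $z\in\mathbb{C}^n$. A set $\Omega$ is invariant under the positive time flows of $F$ if $X(t,z)\in\Omega$ for all $z\in\Omega$ and all $t\ge0$. A domain $\Omega\subseteq\mathbb{C}^n$ is Runge if every holomorphic function $f:\Omega\to\mathbb{C}$ can be approximated by holomorphic polynomials uniformly on every compact subset of $\Omega$. *)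

(* Defs.v *)
From HB Require Import structures.
From mathcomp Require Import all_boot all_order all_algebra complex.
From mathcomp Require mpoly.
From mathcomp Require Import all_classical all_reals all_analysis.

Set Implicit Arguments.
Unset Strict Implicit.
Unset Printing Implicit Defensive.

Import Order.TTheory GRing.Theory Num.Theory numFieldNormedType.Exports.
Local Open Scope classical_set_scope.
Local Open Scope ring_scope.
Local Open Scope complex_scope.

(* The complex numbers.  The type [R[i]] itself has no canonical topology; as a
   [numClosedFieldType] it gets the one defined by the modulus, and so do the
   row vectors C^n = ['rV[Cplx R]_n] (sup norm). *)
Definition Cplx (R : realType) : numClosedFieldType := R[i].

(* Holomorphy on an open set is complex Frechet differentiability at each of its
   points: [differentiable] is taken over the scalar field [Cplx R].  Maps are
   total, but their values outside an open [Omega] are irrelevant. *)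
Definition holomorphic_on (R : realType) (n : nat) (V : normedModType (Cplx R))
    (Omega : set 'rV[Cplx R]_n) (f : 'rV[Cplx R]_n -> V) : Prop :=
  forall z, Omega z -> differentiable f z.

(* The time derivative is with respect to a real variable, whereas C^n is a
   normed module over [Cplx R] only, hence the explicit difference quotient. *)
Definition is_solution (R : realType) (n : nat)
    (F : 'rV[Cplx R]_n -> 'rV[Cplx R]_n) (z : 'rV[Cplx R]_n)
    (x : R -> 'rV[Cplx R]_n) : Prop :=
  x 0 = z /\
  forall t : R,
    (h%:C : Cplx R)^-1 *: (x (t + h) - x t) @[h --> (0 : R)^'] --> F (x t).

Definition complete_field (R : realType) (n : nat)
    (F : 'rV[Cplx R]_n -> 'rV[Cplx R]_n) : Prop :=
  forall z, exists x, is_solution F z x.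

(* X(t, z) = [flow F t z].  For holomorphic F a solution on the whole real line
   is unique when it exists; the constant default is used only when there is
   none, so that [flow F] is meaningful for complete F. *)
Definition flow (R : realType) (n : nat) (F : 'rV[Cplx R]_n -> 'rV[Cplx R]_n)
    (t : R) (z : 'rV[Cplx R]_n) : 'rV[Cplx R]_n :=
  xget (fun=> z) [set x : R -> 'rV[Cplx R]_n | is_solution F z x] t.

(* The Euclidean ball B(0, r), for r > 0; the library's [ball] is a polydisc. *)
Definition eball0 (R : realType) (n : nat) (r : R) : set 'rV[Cplx R]_n :=
  [set z | \sum_(i < n) `|z 0 i| ^+ 2 < (r%:C : Cplx R) ^+ 2].

Definition globally_attracting0 (R : realType) (n : nat)
    (F : 'rV[Cplx R]_n -> 'rV[Cplx R]_n) : Prop :=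
  [/\ F 0 = 0,
      forall eps : R, 0 < eps -> exists2 delta : R, 0 < delta &
        forall z, eball0 delta z ->
        forall t : R, 0 <= t -> eball0 eps (flow F t z)
    & forall z, flow F t z @[t --> +oo] --> (0 : 'rV[Cplx R]_n)].

Definition positively_invariant (R : realType) (n : nat)
    (F : 'rV[Cplx R]_n -> 'rV[Cplx R]_n) (Omega : set 'rV[Cplx R]_n) : Prop :=
  forall z, Omega z -> forall t : R, 0 <= t -> Omega (flow F t z).

Definition is_domain (R : realType) (n : nat) (Omega : set 'rV[Cplx R]_n) :
    Prop :=
  [/\ Omega !=set0, open Omega & connected Omega].

Definition is_runge_domain (R : realType) (n : nat)
    (Omega : set 'rV[Cplx R]_n) : Prop :=
  is_domain Omega /\
  forall f : 'rV[Cplx R]_n -> Cplx R, holomorphic_on Omega f ->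
  forall K : set 'rV[Cplx R]_n, compact K -> K `<=` Omega ->
  forall eps : R, 0 < eps ->
  exists p : mpoly.mpoly n (Cplx R),
    forall z, K z -> `|f z - mpoly.meval (z 0) p| < (eps%:C : Cplx R).

(* Main.v *)
(** Let [V] be the uniform closure of the polynomials in the functions on the
    compact set [K], and let [X_t] be the flow of [F].  The restriction of
    [f o X_t] to [K] is in [V] for [t] large: [X_t] then maps [K] into a small
    ball around 0, on which [f] is a limit of polynomials [p], and [p o X_t] is
    in [V] for every [t >= 0].  The curve [t |-> f o X_t] is real analytic, with
    derivatives [(L^k f) o X_t] where [L g = dg . F], and Cauchy's estimates give
    [|L^k f| <= M A^k k!] near the compact closure of the orbits of [K], so that
    the radius of convergence is bounded below.  Since [V] is closed, analytic
    continuation brings the property from large [t] back to [t = 0].  The same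
    argument run forward shows that [p o X_t] is in [V], and along coordinate
    lines it yields polynomial approximation on balls; holomorphy of [X_t] in the
    space variable is not used.

    The Cauchy theory is built on midpoint sums over the boundary of a square and
    their limits along an ultrafilter, which are linear and bounded on bounded
    functions without any integrability question. *)

Require Import Defs.
From HB Require Import structures.
From mathcomp Require Import all_boot all_order all_algebra complex.
From mathcomp Require mpoly.
From mathcomp Require Import all_classical all_reals all_analysis.
From mathcomp Require Import ring lra zify.
Set Implicit Arguments.
Unset Strict Implicit.
Unset Printing Implicit Defensive.
Import Order.TTheory GRing.Theory Num.Theory numFieldNormedType.Exports.
Local Open Scope classical_set_scope.
Local Open Scope ring_scope.
Local Open Scope complex_scope.

(** * Modulus and ultrafilter limits *)

(** The obstacle is uniformity: continuation reaches time 0 in finitely many steps only if one step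
    length serves all orbits starting in K at all times t >= 0. Attraction provides it. A fixed ball
    around 0 takes care of the late times, compactness of K and of a bounded time interval of the
    early ones; a single radius r and a single bound M then hold along all orbits, and the step is 1
    / (2 A) with A = 8 e M / r.

    The expansion behind [poly_approx] controls a function only on a ball whose radius is smaller,
    by a factor beyond 1 + 16 e, than that of the ball where it is differentiable. The loss is
    harmless: orbits enter every ball around 0, and iterated Lie derivatives of polynomials are
    entire.

    Cauchy's formula is used through bounds, for which the constant 2 pi i may be replaced by any
    number kept away from 0. *)

Section Modulus.
Variable R : realType.
Local Notation C := (Cplx R).
Implicit Types z w : C.

(* The modulus with values in [R]: the norm of [Cplx R] takes its values in the
   partially ordered [Cplx R]. *)
Definition cn (z : C) : R := complex.Re `|z|.

Lemma cnE z : `|z| = (cn z)%:C :> C.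
Proof. by rewrite /cn; case: z => a b. Qed.

Lemma cn_ge0 z : 0 <= cn z.
Proof. by have := normr_ge0 z; rewrite cnE lecR. Qed.

Lemma cn0 : cn 0 = 0. Proof. by rewrite /cn normr0. Qed.
Lemma cn1 : cn 1 = 1. Proof. by rewrite /cn normr1. Qed.
Lemma cnN z : cn (- z) = cn z. Proof. by rewrite /cn normrN. Qed.
Lemma cnB z w : cn (z - w) = cn (w - z). Proof. by rewrite -cnN opprB. Qed.

Lemma cnM z w : cn (z * w) = cn z * cn w.
Proof. by apply: (@complexI R); rewrite rmorphM /= -!cnE normrM. Qed.

Lemma cnV z : cn z^-1 = (cn z)^-1.
Proof. by apply: (@complexI R); rewrite fmorphV /= -!cnE normfV. Qed.

Lemma cnX z k : cn (z ^+ k) = cn z ^+ k.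
Proof. by elim: k => [|k IH]; rewrite ?expr0 ?cn1 // !exprS cnM IH. Qed.

Lemma cnD z w : cn (z + w) <= cn z + cn w.
Proof. by rewrite -lecR rmorphD /= -!cnE; exact: ler_normD. Qed.

Lemma cn_eq0 z : (cn z == 0) = (z == 0).
Proof. by rewrite -[RHS]normr_eq0 cnE (inj_eq (@complexI R)). Qed.

Lemma cn_gt0 z : (0 < cn z) = (z != 0).
Proof. by rewrite lt_def cn_ge0 andbT cn_eq0. Qed.

Lemma cnr (x : R) : cn (x%:C : C) = `|x|.
Proof. by rewrite /cn normc_def /= expr0n addr0 sqrtr_sqr. Qed.

Lemma cnat (k : nat) : cn k%:R = k%:R.
Proof. by rewrite -(rmorph_nat (real_complex R)) cnr normr_nat. Qed.

Lemma cn_i : cn ('i : C) = 1.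
Proof. by rewrite /cn normc_def /= expr0n expr1n add0r sqrtr1. Qed.

Lemma cn_sub_le z w u : cn (z - w) <= cn (z - u) + cn (u - w).
Proof. by rewrite -[z - w](subrKA u) cnD. Qed.

Lemma cn_le_sub z w : cn z <= cn w + cn (z - w).
Proof. by rewrite -{1}[z](subrK w) addrC cnD. Qed.

Lemma Re_le_cn z : `|complex.Re z| <= cn z.
Proof. by have := @normc_ge_Re R z; rewrite [`|z|]cnE lecR. Qed.

Lemma Im_le_cn z : `|complex.Im z| <= cn z.
Proof.
case: z => a b; rewrite /cn normc_def /= -sqrtr_sqr ler_wsqrtr //.
by rewrite lerDr sqr_ge0.
Qed.

Lemma cn_ballE z e w : ball z (e%:C : C) w <-> cn (z - w) < e.
Proof. by rewrite -ball_normE /= cnE ltcR. Qed.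

Lemma cn_nbhs z (A : set C) :
  nbhs z A <-> exists2 e : R, 0 < e & forall w, cn (z - w) < e -> A w.
Proof.
split=> [/nbhs_ballP[e /= e0 eA]|[e e0 eA]]; last first.
  apply/nbhs_ballP; exists (e%:C : C) => /=; first by rewrite ltcR.
  by move=> w /cn_ballE; exact: eA.
have eE : e = (complex.Re e)%:C.
  by have := gtr0_real e0; move/RRe_real => ->.
exists (complex.Re e) => [|w we]; first by rewrite -ltcR -eE.
by apply: eA; rewrite eE; apply/cn_ballE.
Qed.

(** The disc is a closed subset of the image of the square [-M, M]^2 under (a, b) |-> a + ib. *)
Lemma compact_cn (M : R) : compact [set z : C | cn z <= M].
Proof.
pose sq : set (R * R) := `[- M, M] `*` `[- M, M].
pose f (x : R * R) : C := x.1%:C + 'i * x.2%:C.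
have cf : continuous f.
  move=> [a b] /=; apply/cvg_ballP => e e0; near_simpl.
  have eE : e = (complex.Re e)%:C by move/gtr0_real/RRe_real: e0 => ->.
  have re0 : 0 < complex.Re e by rewrite -ltcR -eE.
  near=> x; rewrite eE; apply/cn_ballE.
  have -> : f (a, b) - f x = (a - x.1)%:C + 'i * (b - x.2)%:C.
    by rewrite /f !rmorphB /=; ring.
  apply: le_lt_trans (cnD _ _) _; rewrite cnM cn_i mul1r !cnr [X in _ < X]splitr.
  apply: ltrD; near: x.
    exists ([set y | `|a - y| < complex.Re e / 2], setT) => /=; last by move=> [? ?] [].
    split; last exact: filterT.
    by apply: (@nbhsx_ballx R R); rewrite divr_gt0.
  exists (setT, [set y | `|b - y| < complex.Re e / 2]) => /=; last by move=> [? ?] [].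
  split; first exact: filterT.
  by apply: (@nbhsx_ballx R R); rewrite divr_gt0.
have cD : closed [set z : C | cn z <= M].
  move=> z zcl /=; apply/ler_addgt0Pr => e e0.
  have /zcl[w [/= wM wz]] : nbhs z [set w | cn (z - w) < e].
    by apply/cn_nbhs; exists e.
  by rewrite (le_trans (cn_le_sub z w)) // lerD // ltW.
apply: (subclosed_compact cD (B := f @` sq)).
  apply: continuous_compact; first exact: continuous_subspaceT.
  by apply: compact_setX; exact: segment_compact.
move=> z /= zM; exists (complex.Re z, complex.Im z); last first.
  by rewrite [RHS]complexE.
by rewrite /sq; split; rewrite /= in_itv /= -ler_norml;
  [exact: le_trans (Re_le_cn z) _|exact: le_trans (Im_le_cn z) _].
Unshelve. all: end_near. Qed.

Lemma ex_nat_gt (x : R) : exists k : nat, x < k%:R.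
Proof.
exists (Num.bound `|x|); rewrite (le_lt_trans (ler_norm _)) //.
exact: archi_boundP.
Qed.

End Modulus.

Lemma leq_sum4 (a b c d n : nat) : (a + b + c + d <= n)%N ->
  [/\ (a <= n)%N, (b <= n)%N, (c <= n)%N & (d <= n)%N].
Proof. by move=> h; split; lia. Qed.

Section UltraLimit.
Variable R : realType.
Local Notation C := (Cplx R).
Implicit Types (a b : nat -> C) (z w : C).

(** A refinement of [\oo], so that whatever holds for all large n holds along it. *)
Definition ultra_oo : set_system nat :=
  projT1 (cid (@ultraFilterLemma _ \oo eventually_filter)).

Lemma ultra_ooP : UltraFilter ultra_oo /\ \oo `<=` ultra_oo.
Proof. by rewrite /ultra_oo; case: cid. Qed.

#[global] Instance ultra_oo_ultra : UltraFilter ultra_oo.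
Proof. by case: ultra_ooP. Qed.

Definition Ulim (a : nat -> C) : C := lim (a @ ultra_oo).

Definition bounded_seq a := exists M, forall n, cn (a n) <= M.

(** The image ultrafilter contains a compact disc, hence has a cluster point, and a cluster point of
    an ultrafilter is a limit. *)
Lemma Ulim_near a e : bounded_seq a -> 0 < e ->
  \forall n \near ultra_oo, cn (Ulim a - a n) < e.
Proof.
move=> [M aM] e0.
have aU : ultra_oo (a @^-1` [set z | cn z <= M]) by apply: filterE => n; exact: aM.
have [z [_ clz]] := @compact_cn R M _ (fmap_proper_filter _ _) aU.
have az : a @ ultra_oo --> z.
  move=> A zA; have [//|UA] := in_ultra_setVsetC (a @^-1` A) ultra_oo_ultra.
  have [w [/= nAw Aw]] : ~` A `&` A !=set0 by apply: clz zA; exact: UA.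
  by case: nAw.
have -> : Ulim a = z by apply: (cvg_lim _ az); exact: norm_hausdorff.
have : ultra_oo (a @^-1` [set w | cn (z - w) < e]).
  by apply: az; apply/cn_nbhs; exists e.
by [].
Qed.

Lemma Ulim_eventually (P : set nat) N :
  (forall n, (N <= n)%N -> P n) -> \forall n \near ultra_oo, P n.
Proof. by move=> NP; apply: (proj2 ultra_ooP); exists N. Qed.

Lemma Ulim_uniq a z :
  (forall e, 0 < e -> \forall n \near ultra_oo, cn (z - a n) < e) ->
  bounded_seq a -> Ulim a = z.
Proof.
move=> az ba; apply/eqP; rewrite -subr_eq0 -cn_eq0 eq_le cn_ge0 andbT.
apply/ler_addgt0Pr => e e0; have e20 : 0 < e / 2 by rewrite divr_gt0.
have [n [za aa]] := filter_ex (filterI (az _ e20) (Ulim_near ba e20)).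
rewrite add0r (le_trans (cn_sub_le _ _ (a n))) // [leRHS]splitr.
by rewrite ltW // ltrD // cnB.
Qed.

Lemma Ulim_le a z e N : bounded_seq a ->
  (forall n, (N <= n)%N -> cn (a n - z) <= e) -> cn (Ulim a - z) <= e.
Proof.
move=> ba /Ulim_eventually ae; apply/ler_addgt0Pr => d d0.
have [n [/= za aa]] := filter_ex (filterI ae (Ulim_near ba d0)).
by rewrite (le_trans (cn_sub_le _ _ (a n))) // addrC lerD // ltW.
Qed.

Lemma Ulim_norm a e : (forall n, cn (a n) <= e) -> cn (Ulim a) <= e.
Proof.
move=> ae; rewrite -[Ulim a]subr0; apply: (@Ulim_le _ _ _ 0); first by exists e.
by move=> n _; rewrite subr0.
Qed.

Lemma bounded_seqD a b :
  bounded_seq a -> bounded_seq b -> bounded_seq (fun n => a n + b n).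
Proof.
move=> [M aM] [N bN]; exists (M + N) => n.
by rewrite (le_trans (cnD _ _)) // lerD.
Qed.

Lemma bounded_seqZ a z : bounded_seq a -> bounded_seq (fun n => z * a n).
Proof.
by move=> [M aM]; exists (cn z * M) => n; rewrite cnM ler_wpM2l ?cn_ge0.
Qed.

Lemma UlimD a b : bounded_seq a -> bounded_seq b ->
  Ulim (fun n => a n + b n) = Ulim a + Ulim b.
Proof.
move=> ba bb; apply: Ulim_uniq; last exact: bounded_seqD.
move=> e e0; have e20 : 0 < e / 2 by rewrite divr_gt0.
near=> n; rewrite opprD addrACA (le_lt_trans (cnD _ _)) // [ltRHS]splitr.
by rewrite ltrD //; near: n; exact: Ulim_near.
Unshelve. all: end_near. Qed.

Lemma UlimZ a z : bounded_seq a -> Ulim (fun n => z * a n) = z * Ulim a.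
Proof.
move=> ba; apply: Ulim_uniq; last exact: bounded_seqZ.
move=> e e0; have z1 : 0 < cn z + 1 by rewrite ltr_wpDl ?cn_ge0.
near=> n; rewrite -mulrBr cnM.
have : cn (Ulim a - a n) < e / (cn z + 1).
  by near: n; apply: Ulim_near => //; rewrite divr_gt0.
rewrite ltr_pdivlMr // => /(le_lt_trans _); apply.
by rewrite mulrC ler_wpM2l ?cn_ge0 // lerDl.
Unshelve. all: end_near. Qed.

Lemma Ulim_closed (D : set C) a : closed D -> bounded_seq a ->
  (forall n, D (a n)) -> D (Ulim a).
Proof.
move=> cD ba Da; apply: cD => A /cn_nbhs[e e0 eA].
by have [n /eA An] := filter_ex (Ulim_near ba e0); exists (a n).
Qed.

End UltraLimit.

(** * Goursat's lemma for midpoint sums *)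

Section Goursat.
Variable R : realType.
Local Notation C := (Cplx R).
Implicit Types (phi psi : C -> C) (a b c w p : C).

(** The midpoint Riemann sum over 2^n equal pieces of [a, b]. Bisection makes the subdivision of a
    triangle an exact identity between consecutive levels, [tri_sumS]. *)
Fixpoint mid_sum (n : nat) phi a b : C :=
  if n is m.+1 then mid_sum m phi a ((a + b) / 2) + mid_sum m phi ((a + b) / 2) b
  else phi ((a + b) / 2) * (b - a).

(** The sums sample only dyadic points of a segment, so closure under midpoints suffices. *)
Definition midconvex (S : set C) := forall a b, S a -> S b -> S ((a + b) / 2).

Lemma two_neq0 : (2 : C) != 0. Proof. by rewrite pnatr_eq0. Qed.
Hint Resolve two_neq0 : core.

Lemma cn2 : cn (2 : C) = 2. Proof. exact: cnat. Qed.

Lemma cn_half (w : C) : cn (w / 2) = cn w / 2.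
Proof. by rewrite cnM cnV cn2. Qed.

Lemma midl a b : (a + b) / 2 - a = (b - a) / 2. Proof. by field. Qed.
Lemma midr a b : b - (a + b) / 2 = (b - a) / 2. Proof. by field. Qed.

Lemma mid_sumN n phi a b : mid_sum n phi b a = - mid_sum n phi a b.
Proof.
elim: n a b => [|n IH] a b /=; rewrite (addrC b a); first by rewrite -mulrN opprB.
by rewrite (IH ((a + b) / 2) b) (IH a); ring.
Qed.

Lemma mid_sum_lin n z phi psi a b :
  mid_sum n (fun w => z * phi w + psi w) a b =
  z * mid_sum n phi a b + mid_sum n psi a b.
Proof. by elim: n a b => [|n IH] a b /=; rewrite ?IH; ring. Qed.

(** The midpoint rule is exact on affine functions; their sums around a triangle therefore vanish at
    every level, with no limit to take. *)
Lemma mid_sum_affine n al be a b : mid_sum n (fun w => al + be * w) a b =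
  al * (b - a) + be * (b ^+ 2 - a ^+ 2) / 2.
Proof. by elim: n a b => [|n IH] a b /=; rewrite ?IH; field. Qed.

Lemma mid_sum_ext (S : set C) n phi psi a b : midconvex S ->
  (forall w, S w -> phi w = psi w) -> S a -> S b ->
  mid_sum n phi a b = mid_sum n psi a b.
Proof.
move=> cS e; elim: n a b => [|n IH] a b Sa Sb /=; first by rewrite e //; apply: cS.
by rewrite !IH //; apply: cS.
Qed.

Lemma mid_sum_bound (S : set C) n phi m a b : midconvex S ->
  (forall w, S w -> cn (phi w) <= m) -> S a -> S b ->
  cn (mid_sum n phi a b) <= m * cn (b - a).
Proof.
move=> cS e; elim: n a b => [|n IH] a b Sa Sb /=.
  by rewrite cnM ler_wpM2r ?cn_ge0 // e //; apply: cS.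
rewrite (le_trans (cnD _ _)) //.
have Sm : S ((a + b) / 2) by apply: cS.
have := IH _ _ Sa Sm; have := IH _ _ Sm Sb.
rewrite midl midr cn_half; lra.
Qed.

Definition tri_sum n phi a b c :=
  mid_sum n phi a b + mid_sum n phi b c + mid_sum n phi c a.

Lemma tri_sumS n phi a b c : tri_sum n.+1 phi a b c =
  tri_sum n phi a ((a + b) / 2) ((c + a) / 2) +
  tri_sum n phi ((a + b) / 2) b ((b + c) / 2) +
  tri_sum n phi ((c + a) / 2) ((b + c) / 2) c +
  tri_sum n phi ((a + b) / 2) ((b + c) / 2) ((c + a) / 2).
Proof.
rewrite /tri_sum /=.
rewrite (mid_sumN _ _ ((c + a) / 2) ((a + b) / 2)).
rewrite (mid_sumN _ _ ((a + b) / 2) ((b + c) / 2)).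
rewrite (mid_sumN _ _ ((b + c) / 2) ((c + a) / 2)); ring.
Qed.

Lemma tri_sum_lin n z phi psi a b c :
  tri_sum n (fun w => z * phi w + psi w) a b c =
  z * tri_sum n phi a b c + tri_sum n psi a b c.
Proof. by rewrite /tri_sum !mid_sum_lin; ring. Qed.

Lemma tri_sum_affine n al be a b c : tri_sum n (fun w => al + be * w) a b c = 0.
Proof. by rewrite /tri_sum !mid_sum_affine; field. Qed.

Lemma midconvex_ball p r : midconvex [set w | cn (w - p) <= r].
Proof.
move=> a b /= ar br; have -> : (a + b) / 2 - p = (a - p) / 2 + (b - p) / 2 by field.
rewrite (le_trans (cnD _ _)) // !cn_half; lra.
Qed.

Definition cdiff phi p := exists l : C, forall e : R, 0 < e ->
  exists2 d : R, 0 < d & forall w, cn (w - p) < d ->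
  cn (phi w - phi p - l * (w - p)) <= e * cn (w - p).

(** The affine part of [phi] at p contributes nothing, and the remainder is at most e r on the disc;
    what is left is e r times the perimeter. *)
Lemma tri_sum_small phi p a b c l e r n :
  (forall w, cn (w - p) <= r -> cn (phi w - phi p - l * (w - p)) <= e * cn (w - p)) ->
  cn (a - p) <= r -> cn (b - p) <= r -> cn (c - p) <= r -> 0 <= e ->
  cn (tri_sum n phi a b c) <= e * r * (cn (b - a) + cn (c - b) + cn (a - c)).
Proof.
move=> phie ar br cr e0; pose rem w := phi w - phi p - l * (w - p).
have -> : tri_sum n phi a b c = tri_sum n rem a b c.
  have E1 : phi = (fun w => 1 * rem w + ((phi p - l * p) + l * w)).
    by apply/funext => w; rewrite /rem; ring.
  by rewrite {1}E1 tri_sum_lin tri_sum_affine; ring.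
have rb w : cn (w - p) <= r -> cn (rem w) <= e * r.
  by move=> wr; rewrite (le_trans (phie _ wr)) // ler_wpM2l.
have B x y : cn (x - p) <= r -> cn (y - p) <= r ->
    cn (mid_sum n rem x y) <= e * r * cn (y - x).
  by move=> xr yr; apply: (mid_sum_bound n (@midconvex_ball p r)).
rewrite /tri_sum !mulrDr.
by rewrite (le_trans (cnD _ _)) // lerD ?B // (le_trans (cnD _ _)) // lerD ?B.
Qed.

(** The classical bisection, run on sums: a triangle is bad for e when its sums exceed e at
    arbitrarily high levels. A triangle bad for 4 e' has a subtriangle bad for e', and the nested
    triangles shrink to a point of D, where differentiability contradicts badness. *)
Theorem goursat (D : set C) phi : closed D -> (exists M, forall w, D w -> cn w <= M) ->
  midconvex D -> (forall w, D w -> cdiff phi w) ->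
  forall a b c, D a -> D b -> D c -> forall e, 0 < e ->
  exists N, forall n, (N <= n)%N -> cn (tri_sum n phi a b c) <= e.
Proof.
move=> Dc [M DM] Dm dphi a b c Da Db Dcc e e0.
apply: contrapT => nN.
pose bad e (t : C * C * C) := forall N, exists2 n, (N <= n)%N &
  e < cn (tri_sum n phi t.1.1 t.1.2 t.2).
pose inD (t : C * C * C) := [/\ D t.1.1, D t.1.2 & D t.2].
pose dia (t : C * C * C) d :=
  [/\ cn (t.1.2 - t.1.1) <= d, cn (t.2 - t.1.2) <= d & cn (t.1.1 - t.2) <= d].
have bad_sub e' t : bad (4 * e') t -> inD t -> forall d, dia t d ->
   exists t', [/\ bad e' t', inD t', dia t' (d / 2) & cn (t'.1.1 - t.1.1) <= d].
  case: t => [[x y] z] bt [/= Dx Dy Dz] d [/= d1 d2 d3].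
  have d0 : 0 <= d := le_trans (cn_ge0 _) d1.
  apply: contrapT => nt.
  have nb t' : inD t' -> dia t' (d / 2) -> cn (t'.1.1 - x) <= d ->
      exists N, forall n, (N <= n)%N -> cn (tri_sum n phi t'.1.1 t'.1.2 t'.2) <= e'.
    move=> it dt ct; apply: contrapT => nN'; apply: nt; exists t'; split => //.
    move=> N; apply: contrapT => nn; apply: nN'; exists N => n Nn.
    by rewrite leNgt; apply/negP => en; apply: nn; exists n.
  have hN w : cn w <= d -> cn (w / 2) <= d / 2 by move=> ?; rewrite cn_half ler_pM2r.
  have hN' w : cn w <= d -> cn (- w / 2) <= d / 2.
    by move=> ?; rewrite cn_half cnN ler_pM2r.
  have dd : d / 2 <= d by lra.
  have [|||N1 H1] := nb (x, (x + y) / 2, (z + x) / 2).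
  - by split => //=; apply: Dm.
  - split => /=.
    + by rewrite midl hN.
    + by rewrite (_ : _ - _ = (z - y) / 2) ?hN //; field.
    + by rewrite (_ : _ - _ = (x - z) / 2) ?hN //; field.
  - by rewrite /= subrr cn0.
  have [|||N2 H2] := nb ((x + y) / 2, y, (y + z) / 2).
  - by split => //=; apply: Dm.
  - split => /=.
    + by rewrite midr hN.
    + by rewrite midl hN.
    + by rewrite (_ : _ - _ = (x - z) / 2) ?hN //; field.
  - by rewrite /= midl (le_trans (hN _ _)).
  have [|||N3 H3] := nb ((z + x) / 2, (y + z) / 2, z).
  - by split => //=; apply: Dm.
  - split => /=.
    + by rewrite (_ : _ - _ = (y - x) / 2) ?hN //; field.
    + by rewrite midr hN.
    + by rewrite midl hN.
  - by rewrite /= (_ : _ - _ = - (x - z) / 2) ?(le_trans (hN' _ _)) //; field.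
  have [|||N4 H4] := nb ((x + y) / 2, (y + z) / 2, (z + x) / 2).
  - by split => //=; apply: Dm.
  - split => /=.
    + by rewrite (_ : _ - _ = - (x - z) / 2) ?hN' //; field.
    + by rewrite (_ : _ - _ = - (y - x) / 2) ?hN' //; field.
    + by rewrite (_ : _ - _ = - (z - y) / 2) ?hN' //; field.
  - by rewrite /= midl (le_trans (hN _ _)).
  (* [tri_sumS] lowers the level by one, hence a bad level n.+1 with n beyond the four
     thresholds. *)
  have [n] := bt (N1 + N2 + N3 + N4).+1.
  case: n => // n; rewrite ltnS => nn /=; apply/negP; rewrite -leNgt tri_sumS.
  have [n1 n2 n3 n4] := leq_sum4 nn.
  move: (H1 _ n1) (H2 _ n2) (H3 _ n3) (H4 _ n4) => /= {}H1 {}H2 {}H3 {}H4.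
  rewrite (_ : 4 * e' = e' + e' + e' + e'); last by ring.
  by do 3 (rewrite (le_trans (cnD _ _)) // lerD //).
(* The added 1 keeps this bound on the sides positive for a degenerate triangle. *)
pose d := cn (b - a) + cn (c - b) + cn (a - c) + 1.
have d0 : 0 < d by rewrite /d ltr_wpDl // !addr_ge0 ?cn_ge0.
pose P k t := [/\ bad (e / 4 ^+ k) t, inD t & dia t (d / 2 ^+ k)].
pose nxt k t := xget t [set t' | P k.+1 t' /\ cn (t'.1.1 - t.1.1) <= d / 2 ^+ k].
have nxtP k t : P k t -> P k.+1 (nxt k t) /\ cn ((nxt k t).1.1 - t.1.1) <= d / 2 ^+ k.
  move=> [bt it dt].
suff ex : exists t', [set t' | P k.+1 t' /\ cn (t'.1.1 - t.1.1) <= d / 2 ^+ k] t'.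
  exact: (xgetPex t ex).
  have [|t' [? ? ? ?]] := @bad_sub (e / 4 ^+ k.+1) t _ it _ dt.
    by rewrite (_ : 4 * _ = e / 4 ^+ k) // exprS; field; rewrite expf_neq0 ?pnatr_eq0.
  exists t'; split => //; split => //.
  by rewrite (_ : _ / _ = d / 2 ^+ k / 2) // exprS; field; rewrite expf_neq0 ?pnatr_eq0.
pose tri := fix F k := if k is m.+1 then nxt m (F m) else (a, b, c).
have triP k : P k (tri k).
  elim: k => [|k IH]; last exact: (nxtP _ _ IH).1.
  rewrite /P expr0 divr1 /=; split => //.
  - move=> N; apply: contrapT => nn; apply: nN; exists N => n Nn.
    by rewrite leNgt; apply/negP => en; apply: nn; exists n => //; rewrite invr1 mulr1 in en.
  - have h1 := cn_ge0 (b - a); have h2 := cn_ge0 (c - b); have h3 := cn_ge0 (a - c).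
    by split; rewrite /= /d; lra.
pose q k := (tri k).1.1.
have p2 k : 0 < 2 ^+ k :> R by rewrite exprn_gt0.
have qk m k : cn (q (k + m)%N - q k) <= d / 2 ^+ k * (2 - 2 / 2 ^+ m).
  elim: m => [|m IH]; first by rewrite addn0 subrr cn0 expr0; lra.
  rewrite addnS (le_trans (cn_sub_le _ _ (q (k + m)%N))) //.
  have [_ h] := nxtP _ _ (triP (k + m)%N).
  apply: le_trans (lerD h IH) _.
  rewrite exprD exprS le_eqVlt; apply/orP; left; apply/eqP.
  by field; rewrite !gt_eqF.
have bq : bounded_seq q by exists M => n; have [_ [? _ _] _] := triP n; apply: DM.
pose p := Ulim q.
have Dp : D p by apply: Ulim_closed => // n; have [_ [? _ _] _] := triP n.
have pk k : cn (p - q k) <= 2 * d / 2 ^+ k.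
  apply: (@Ulim_le _ q _ _ k) => // n kn; rewrite -(subnKC kn).
  apply: le_trans (qk _ _) _; rewrite (mulrC 2 d) -!mulrA ler_pM2l //.
  rewrite mulrC ler_pM2r ?invr_gt0 // lerBlDr lerDl divr_ge0 // ltW //.
have [l dl] := dphi _ Dp.
(* At stage k the vertices are within 3 d / 2^k of p and the perimeter is at most 3 d / 2^k, so this
   slope error yields exactly e / 4^k, the threshold of badness at stage k. *)
have [|dd dd0 {}dl] := dl (e / (9 * d ^+ 2)); first by rewrite divr_gt0 ?mulr_gt0 ?exprn_gt0.
have [k kd] : exists k, 3 * d / 2 ^+ k < dd.
  have [k hk] := ex_nat_gt (3 * d / dd).
  have hk2 : k%:R <= 2 ^+ k :> R by rewrite -natrX ler_nat ltnW // ltn_expl.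
  exists k; rewrite ltr_pdivrMr // [ltRHS]mulrC -ltr_pdivrMr //.
  exact: lt_le_trans hk hk2.
have [bt it [h1 h2 h3]] := triP k.
have [n _] := bt 0%N; apply/negP; rewrite -leNgt.
have v1 := pk k; rewrite cnB /q in v1.
set x := (tri k).1.1 in v1 h1 h3 *; set y := (tri k).1.2 in h1 h2 *.
set z := (tri k).2 in h2 h3 *.
have v2 : cn (y - p) <= 3 * d / 2 ^+ k.
  apply: le_trans (cn_sub_le _ _ x) _; apply: le_trans (lerD h1 v1) _.
  by rewrite -mulrDl; rewrite ler_pM2r ?invr_gt0 //; lra.
have v3 : cn (z - p) <= 3 * d / 2 ^+ k.
  rewrite cnB in h3.
  apply: le_trans (cn_sub_le _ _ x) _; apply: le_trans (lerD h3 v1) _.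
  by rewrite -mulrDl; rewrite ler_pM2r ?invr_gt0 //; lra.
have {}v1 : cn (x - p) <= 3 * d / 2 ^+ k.
  by rewrite (le_trans v1) // ler_pM2r ?invr_gt0 //; lra.
have ge := @tri_sum_small phi p x y z l (e / (9 * d ^+ 2)) (3 * d / 2 ^+ k) n _ v1 v2 v3 _.
apply: le_trans (ge _ _) _.
- by move=> w wr; apply: dl; exact: le_lt_trans wr kd.
- by rewrite divr_ge0 // ?mulr_ge0 ?exprn_ge0 // ltW.
have s3 : cn (y - x) + cn (z - y) + cn (x - z) <= 3 * (d / 2 ^+ k) by lra.
apply: le_trans (ler_wpM2l _ s3) _.
  by rewrite !mulr_ge0 ?invr_ge0 ?mulr_ge0 ?exprn_ge0 // ltW.
rewrite le_eqVlt; apply/orP; left; apply/eqP.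
have -> : (4 : R) ^+ k = 2 ^+ k * 2 ^+ k.
  by rewrite -exprMn; congr (_ ^+ _); rewrite -natrM.
by field; rewrite !gt_eqF.
Qed.
End Goursat.

(** * Cauchy's formula on a square *)

Section CauchySquare.
Variable R : realType.
Local Notation C := (Cplx R).
Implicit Types (phi psi g : C -> C) (a b c w p z : C).

Lemma Re_half w : complex.Re (w / 2) = complex.Re w / 2.
Proof.
have {2}-> : w = w / 2 + w / 2 by field.
by case: (w / 2) => x y /=; field.
Qed.

Lemma ReD w z : complex.Re (w + z) = complex.Re w + complex.Re z.
Proof. by case: w z => [? ?] []. Qed.

Lemma midconvex_half (lam p : C) (c : R) :
  midconvex [set w | c <= complex.Re (lam * (w - p))].
Proof.
move=> a b /= ac bc.
have -> : lam * ((a + b) / 2 - p) = lam * (a - p) / 2 + lam * (b - p) / 2 by field.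
rewrite ReD !Re_half; lra.
Qed.

Lemma midconvexI (S T : set C) : midconvex S -> midconvex T -> midconvex (S `&` T).
Proof. by move=> cS cT a b [Sa Ta] [Sb Tb]; split; [exact: cS|exact: cT]. Qed.

Lemma closed_ballC (r : R) : closed [set w : C | cn w <= r].
Proof. exact: compact_closed (@norm_hausdorff _ _) (@compact_cn R r). Qed.

Lemma closed_half (lam p : C) (c : R) :
  closed [set w | c <= complex.Re (lam * (w - p))].
Proof.
move=> z zcl /=; apply/ler_addgt0Pr => e e0.
have l1 : 0 < cn lam + 1 by rewrite ltr_wpDl ?cn_ge0.
have /zcl[w [/= wM wz]] : nbhs z [set w | cn (z - w) < e / (cn lam + 1)].
  by apply/cn_nbhs; exists (e / (cn lam + 1)); rewrite ?divr_gt0.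
have -> : lam * (z - p) = lam * (w - p) + lam * (z - w) by ring.
rewrite ReD -addrA ler_wpDr // -lerBlDl sub0r.
apply: le_trans (ler_norm _) _; rewrite normrN; apply: le_trans (Re_le_cn _) _.
rewrite cnM; move: wz; rewrite ltr_pdivlMr // => /ltW; apply: le_trans.
by rewrite mulrC ler_wpM2l ?cn_ge0 // lerDl.
Qed.

(** The vertices lie in an open half plane whose boundary passes through p, so the triangle stays
    away from p; [goursat] applies on the part of the disc at level at least m, the least of the
    three real parts. *)
Lemma triangle_half (lam p : C) (r : R) phi a b c :
  (forall w, cn w <= r -> w != p -> cdiff phi w) ->
  cn a <= r -> cn b <= r -> cn c <= r ->
  0 < complex.Re (lam * (a - p)) -> 0 < complex.Re (lam * (b - p)) ->
  0 < complex.Re (lam * (c - p)) ->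
  forall e, 0 < e -> exists N, forall n, (N <= n)%N -> cn (tri_sum n phi a b c) <= e.
Proof.
move=> dphi ar br cr a0 b0 c0.
set x := complex.Re (lam * (a - p)) in a0 *.
set y := complex.Re (lam * (b - p)) in b0 *.
set t := complex.Re (lam * (c - p)) in c0 *.
pose m := Num.min x (Num.min y t).
have m0 : 0 < m by rewrite !lt_min a0 b0 c0.
pose D := [set w : C | cn w <= r] `&` [set w | m <= complex.Re (lam * (w - p))].
apply: (@goursat _ D).
- by apply: closedI; [exact: closed_ballC|exact: closed_half].
- by exists r => w [].
- apply: midconvexI; last exact: midconvex_half.
  by move=> u v ur vr; have := @midconvex_ball _ 0 r u v; rewrite /= !subr0; apply.
- move=> w [wr /= mw]; apply: dphi => //; apply: contraTneq mw => ->.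
  by rewrite subrr mulr0 /= -ltNge.
- by split => //=; rewrite /m !ge_min lexx.
- by split => //=; rewrite /m !ge_min lexx orbT.
- by split => //=; rewrite /m !ge_min lexx !orbT.
Qed.

(* A singularity at a vertex [p] is harmless when [phi] is bounded: only one of
   the four subtriangles contains [p], and its perimeter halves at each step. *)
Lemma triangle_star (lam p : C) (r m : R) phi a b :
  (forall w, cn w <= r -> w != p -> cdiff phi w) ->
  (forall w, cn w <= r -> cn (phi w) <= m) ->
  cn p <= r -> cn a <= r -> cn b <= r ->
  0 < complex.Re (lam * (a - p)) -> 0 < complex.Re (lam * (b - p)) ->
  forall e, 0 < e -> exists N, forall n, (N <= n)%N -> cn (tri_sum n phi p a b) <= e.
Proof.
move=> dphi phim pr + + + +.
have cr : midconvex [set w : C | cn w <= r].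
  by move=> u v ur vr; have := @midconvex_ball _ 0 r u v; rewrite /= !subr0; apply.
have m0 : 0 <= m := le_trans (cn_ge0 _) (phim _ pr).
move=> ar br a0 b0.
pose d := cn (a - p) + cn (b - p).
(* When both sides at p are at most d / 2^k, the perimeter is at most 4 d / 2^k; l counts the
   subdivisions still to come. *)
suff H k : forall a b, cn a <= r -> cn b <= r -> 0 < complex.Re (lam * (a - p)) ->
    0 < complex.Re (lam * (b - p)) -> cn (a - p) <= d / 2 ^+ k -> cn (b - p) <= d / 2 ^+ k ->
    forall l e, 0 < e -> exists N, forall n, (N <= n)%N ->
      cn (tri_sum n phi p a b) <= e + 4 * m * d / 2 ^+ (k + l).
  move=> e e0; have e20 : 0 < e / 2 by rewrite divr_gt0.
  have [l hl] := ex_nat_gt (4 * m * d / (e / 2)).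
  have hl2 : l%:R <= 2 ^+ l :> R by rewrite -natrX ler_nat ltnW // ltn_expl.
  have h1 := cn_ge0 (a - p); have h2 := cn_ge0 (b - p).
  have [||N HN] := H 0%N a b ar br a0 b0 _ _ l _ e20.
  - by rewrite expr0 divr1 /d lerDl.
  - by rewrite expr0 divr1 /d lerDr.
  exists N => n /HN; rewrite add0n => /le_trans; apply.
  rewrite [leRHS]splitr lerD2l ler_pdivrMr ?exprn_gt0 // [leRHS]mulrC -ler_pdivrMr //.
  exact: le_trans (ltW hl) hl2.
clearbody d; move=> {}a {}b {}ar {}br {}a0 {}b0 ad bd l.
elim: l k a b ar br a0 b0 ad bd => [|l IH] k a b ar br a0 b0 ad bd e e0.
  exists 0%N => n _; rewrite addn0.
  have B x y : cn x <= r -> cn y <= r -> cn (mid_sum n phi x y) <= m * cn (y - x).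
    by move=> xr yr; apply: (mid_sum_bound n cr).
  have ab : cn (b - a) <= d / 2 ^+ k + d / 2 ^+ k.
    by rewrite (le_trans (cn_sub_le _ _ p)) // lerD // cnB.
  have bd' : cn (p - b) <= d / 2 ^+ k by rewrite cnB.
  rewrite /tri_sum; apply: le_trans (cnD _ _) _.
  apply: le_trans (lerD (cnD _ _) (lexx _)) _.
  apply: le_trans (lerD (lerD (B _ _ pr ar) (B _ _ ar br)) (B _ _ br pr)) _.
  have := ler_wpM2l m0 ad; have := ler_wpM2l m0 ab; have := ler_wpM2l m0 bd'.
  rewrite -!mulrA !mulrDr; lra.
have hf (x y : C) : 0 < complex.Re (lam * (x - p)) -> 0 <= complex.Re (lam * (y - p)) ->
    0 < complex.Re (lam * ((x + y) / 2 - p)).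
  move=> x0 y0.
  have -> : lam * ((x + y) / 2 - p) = lam * (x - p) / 2 + lam * (y - p) / 2 by field.
  rewrite ReD !Re_half; lra.
have p0 : 0 <= complex.Re (lam * (p - p)) by rewrite subrr mulr0.
have e40 : 0 < e / 4 by rewrite divr_gt0.
have pa0 : 0 < complex.Re (lam * ((p + a) / 2 - p)) by rewrite (addrC p); apply: hf.
have bp0 : 0 < complex.Re (lam * ((b + p) / 2 - p)) by rewrite hf.
have ab0 : 0 < complex.Re (lam * ((a + b) / 2 - p)) by rewrite hf // ltW.
have par : cn ((p + a) / 2) <= r by apply: cr.
have bpr : cn ((b + p) / 2) <= r by apply: cr.
have abr : cn ((a + b) / 2) <= r by apply: cr.
have T := triangle_half dphi.
have [N1 H1] := T lam _ _ _ par ar abr pa0 a0 ab0 _ e40.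
have [N2 H2] := T lam _ _ _ bpr abr br bp0 ab0 b0 _ e40.
have [N3 H3] := T lam _ _ _ par abr bpr pa0 ab0 bp0 _ e40.
have [||N4 H4] := IH k.+1 _ _ par bpr pa0 bp0 _ _ _ e40.
- by rewrite midl cn_half exprSr invfM mulrA ler_pM2r ?invr_gt0.
- by rewrite (addrC b) midl cn_half exprSr invfM mulrA ler_pM2r ?invr_gt0.
exists (N1 + N2 + N3 + N4).+1 => -[//|n]; rewrite ltnS => nn.
have [n1 n2 n3 n4] := leq_sum4 nn.
move: (H1 _ n1) (H2 _ n2) (H3 _ n3) (H4 _ n4) => {}H1 {}H2 {}H3 {}H4.
rewrite tri_sumS addnS -addSn.
apply: le_trans (cnD _ _) _; apply: le_trans (lerD (cnD _ _) (lexx _)) _.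
apply: le_trans (lerD (lerD (cnD _ _) (lexx _)) (lexx _)) _; lra.
Qed.

Definition sq_sum n phi :=
  mid_sum n phi (1 - 'i) (1 + 'i) + mid_sum n phi (1 + 'i) (-1 + 'i) +
  mid_sum n phi (-1 + 'i) (-1 - 'i) + mid_sum n phi (-1 - 'i) (1 - 'i).

(** An annulus containing the boundary of the square with vertices 1 - i, 1 + i, -1 + i, -1 - i; 3 /
    2 is a rational bound for the square root of 2. *)
Definition ring_set : set C := [set w | 1 <= cn w <= 3 / 2].

Lemma ii : 'i * 'i = -1 :> C. Proof. by rewrite -expr2 sqr_i. Qed.

Lemma corner_cn z : complex.Re z ^+ 2 = 1 -> complex.Im z ^+ 2 = 1 -> cn z <= 3 / 2.
Proof.
move=> x1 y1; rewrite /cn normc_def /= x1 y1 -[leRHS]ger0_norm; last by lra.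
rewrite -sqrtr_sqr ler_wsqrtr //; lra.
Qed.

(** For lam = 1, -i, -1, i, a midpoint-convex set containing the side of the square that
    multiplication by lam carries to the line Re w = 1. *)
Definition edge (lam : C) : set C :=
  [set w | cn w <= 3 / 2] `&` [set w | 1 <= complex.Re (lam * (w - 0))].

Lemma edge_convex lam : midconvex (edge lam).
Proof.
apply: midconvexI; last exact: midconvex_half.
by move=> u v ur vr; have := @midconvex_ball _ 0 (3/2) u v; rewrite /= !subr0; apply.
Qed.

Lemma edge_ring lam : cn lam = 1 -> edge lam `<=` ring_set.
Proof.
move=> l1 w [/= w1]; rewrite subr0 => w2; rewrite /ring_set /= w1 andbT.
apply: le_trans w2 _; apply: le_trans (ler_norm _) _.
by apply: le_trans (Re_le_cn _) _; rewrite cnM l1 mul1r.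
Qed.

Lemma c1i : cn (1 + 'i : C) <= 3 / 2.
Proof. by apply: corner_cn => /=; ring. Qed.
Lemma c1mi : cn (1 - 'i : C) <= 3 / 2.
Proof. by apply: corner_cn => /=; ring. Qed.
Lemma cm1i : cn (-1 + 'i : C) <= 3 / 2.
Proof. by apply: corner_cn => /=; ring. Qed.
Lemma cm1mi : cn (-1 - 'i : C) <= 3 / 2.
Proof. by apply: corner_cn => /=; ring. Qed.

Lemma edgeP lam w : cn w <= 3 / 2 -> complex.Re (lam * w) = 1 -> edge lam w.
Proof. by move=> w1 w2; split => //=; rewrite subr0 w2. Qed.

Lemma edge1 : edge 1 (1 - 'i) /\ edge 1 (1 + 'i).
Proof. by split; apply: edgeP; rewrite ?c1i ?c1mi //= /=; lra. Qed.
Lemma edge2 : edge (- 'i) (1 + 'i) /\ edge (- 'i) (-1 + 'i).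
Proof. by split; apply: edgeP; rewrite ?c1i ?cm1i //= /=; lra. Qed.
Lemma edge3 : edge (-1) (-1 + 'i) /\ edge (-1) (-1 - 'i).
Proof. by split; apply: edgeP; rewrite ?cm1mi ?cm1i //= /=; lra. Qed.
Lemma edge4 : edge 'i (-1 - 'i) /\ edge 'i (1 - 'i).
Proof. by split; apply: edgeP; rewrite ?cm1mi ?c1mi //= /=; lra. Qed.

Lemma cn_unit : [/\ cn (1 : C) = 1, cn (- 'i : C) = 1, cn (-1 : C) = 1 & cn ('i : C) = 1].
Proof. by rewrite !cnN cn1 cn_i. Qed.

Lemma sq_sum_ext n phi psi : (forall w, ring_set w -> phi w = psi w) ->
  sq_sum n phi = sq_sum n psi.
Proof.
move=> e; have [u1 u2 u3 u4] := cn_unit.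
have [? ?] := edge1; have [? ?] := edge2; have [? ?] := edge3; have [? ?] := edge4.
have B lam a b : cn lam = 1 -> edge lam a -> edge lam b ->
    mid_sum n phi a b = mid_sum n psi a b.
  move=> l1; apply: (mid_sum_ext n (@edge_convex lam)) => w we.
  by apply: e; apply: edge_ring we.
by congr (_ + _ + _ + _); [apply: (B 1)|apply: (B (- 'i))|apply: (B (-1))|apply: (B 'i)].
Qed.

Lemma sq_sum_lin n z phi psi :
  sq_sum n (fun w => z * phi w + psi w) = z * sq_sum n phi + sq_sum n psi.
Proof. by rewrite /sq_sum !mid_sum_lin; ring. Qed.

(** The factor 8 is the length of the contour. *)
Lemma sq_sum_bound n phi m : (forall w, ring_set w -> cn (phi w) <= m) ->
  cn (sq_sum n phi) <= 8 * m.
Proof.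
move=> e; have [u1 u2 u3 u4] := cn_unit.
have [? ?] := edge1; have [? ?] := edge2; have [? ?] := edge3; have [? ?] := edge4.
have B lam a b : cn lam = 1 -> edge lam a -> edge lam b -> b - a = 2 * 'i * lam^-1 ->
    cn (mid_sum n phi a b) <= 2 * m.
  move=> l1 ea eb ab; apply: le_trans (mid_sum_bound n (@edge_convex lam) _ ea eb) _.
    by move=> w we; apply: e; apply: edge_ring we.
  by rewrite ab !cnM cn2 cn_i cnV l1 invr1 !mulr1 mulrC.
rewrite /sq_sum; apply: le_trans (cnD _ _) _; apply: le_trans (lerD (cnD _ _) (lexx _)) _.
apply: le_trans (lerD (lerD (cnD _ _) (lexx _)) (lexx _)) _.
have i0 : 'i != 0 :> C by rewrite -cn_eq0 cn_i oner_eq0.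
have iV : 'i^-1 = - 'i :> C by apply: (mulIf i0); rewrite mulVf // mulNr ii opprK.
have B1 := B 1 (1 - 'i) (1 + 'i); have B2 := B (- 'i) (1 + 'i) (-1 + 'i).
have B3 := B (-1) (-1 + 'i) (-1 - 'i); have B4 := B 'i (-1 - 'i) (1 - 'i).
rewrite (_ : 8 * m = 2 * m + 2 * m + 2 * m + 2 * m); last by ring.
rewrite !lerD ?B1 ?B2 ?B3 ?B4 // ?invrN ?invr1 ?iV.
- by ring.
- by rewrite opprK -mulrA ii; ring.
- by ring.
- by rewrite -mulrA mulrN ii; ring.
Qed.

Lemma mid_sum0 phi a b : mid_sum 0 phi a b = phi ((a + b) / 2) * (b - a).
Proof. by []. Qed.

Lemma mid_sumS n phi a b : mid_sum n.+1 phi a b =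
  mid_sum n phi a ((a + b) / 2) + mid_sum n phi ((a + b) / 2) b.
Proof. by []. Qed.

(** This stands in for the value 2 pi i. The form dw / w is invariant under w |-> iw, so the four
    sides contribute equally; on the side Re w = 1 a piece from 1 + ia to 1 + ib with midpoint 1 +
    im contributes the imaginary part (b - a) / (1 + m^2) >= (b - a) / 2, which adds up to at least
    1. *)
Lemma sq_sum_inv n : 4 <= cn (sq_sum n (fun w => w^-1)).
Proof.
have i0 : 'i != 0 :> C by rewrite -cn_eq0 cn_i oner_eq0.
have rot k a b : mid_sum k (fun w => w^-1) ('i * a) ('i * b) = mid_sum k (fun w => w^-1) a b.
  elim: k a b => [|k IH] a b /=; rewrite -mulrDr -mulrA ?IH //.
  by rewrite invfM -mulrBr mulrACA mulVf // mul1r.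
have re1 a b : complex.Re a = 1 -> complex.Re b = 1 -> -1 <= complex.Im a ->
    complex.Im b <= 1 -> complex.Im a <= complex.Im b ->
    (complex.Im b - complex.Im a) / 2 <= complex.Im (mid_sum n (fun w => w^-1) a b).
  move: n => {}n; have mE (u v : R) : ((1 +i* u)%C + (1 +i* v)%C : C) / 2 = (1 +i* ((u + v) / 2))%C.
    apply: (mulIf (@two_neq0 R)); rewrite divfK ?two_neq0 //.
    by apply/eqP; rewrite eq_complex /=; apply/andP; split; apply/eqP; field.
  case: a b => [a1 a] [b1 b] /= -> ->; elim: n a b => [|n IH] a b a1' b1' ab.
    rewrite mid_sum0 mE; set m := (a + b) / 2.
    have m1 : m ^+ 2 <= 1 by rewrite -real_normK ?num_real // expr_le1 // ler_norml /m; lra.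
    have m2 : 0 < 1 + m ^+ 2 by rewrite ltr_wpDr ?sqr_ge0.
    rewrite /= !expr1n !subrr mulr0 mul1r.
    have h : 2^-1 * (b - a) <= (1 + m ^+ 2)^-1 * (b - a).
      by rewrite ler_wpM2r ?subr_ge0 // lef_pV2 ?posrE //; lra.
    lra.
  rewrite mid_sumS mE; have := IH a ((a + b) / 2); have := IH ((a + b) / 2) b.
  set x := mid_sum _ _ _ _; set y := mid_sum _ _ _ _.
  have -> : complex.Im (y + x) = complex.Im x + complex.Im y.
    by case: (x) (y) => [? ?] [? ?] /=; ring.
  lra.
have e1 : 'i * (1 - 'i) = 1 + 'i :> C by rewrite mulrBr ii; ring.
have e2 : 'i * (1 + 'i) = -1 + 'i :> C by rewrite mulrDr ii; ring.
have e3 : 'i * (-1 + 'i) = -1 - 'i :> C by rewrite mulrDr ii; ring.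
have e4 : 'i * (-1 - 'i) = 1 - 'i :> C by rewrite mulrBr ii; ring.
have r1 := rot n (1 - 'i) (1 + 'i); rewrite e1 e2 in r1.
have r2 := rot n (1 + 'i) (-1 + 'i); rewrite e2 e3 in r2.
have r3 := rot n (-1 + 'i) (-1 - 'i); rewrite e3 e4 in r3.
rewrite /sq_sum r3 r2 r1.
have := re1 (1 - 'i) (1 + 'i).
set x := mid_sum _ _ _ _ => h.
have {}h : 1 <= complex.Im x by apply: le_trans (h _ _ _ _ _); rewrite /=; lra.
have -> : x + x + x + x = 4 * x by ring.
rewrite cnM cnat; have := Im_le_cn x; have := ler_norm (complex.Im x); lra.
Qed.
End CauchySquare.

(** * Cauchy's formula for the derivative, with a second order remainder *)

Section CauchyKey.
Variable R : realType.
Local Notation C := (Cplx R).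
Implicit Types (phi psi g : C -> C) (a b c w p z : C).

Lemma cn_ge_sub z w : cn z - cn w <= cn (z - w).
Proof. by rewrite lerBlDl cn_le_sub. Qed.

Lemma cdiff_quot g c z p : cdiff g p -> p != z ->
  cdiff (fun w => if w == z then 0 else (g w - c) / (w - z)) p.
Proof.
move=> [l gl] pz; have pz0 : p - z != 0 by rewrite subr_eq0.
set q := cn (p - z); have q0 : 0 < q by rewrite cn_gt0.
pose h := (g p - c) / (p - z); exists ((l - h) / (p - z)) => e e0.
set A := cn (l - h); have A0 : 0 <= A := cn_ge0 _.
have [|d d0 gd] := gl (e * q / 4); first by rewrite divr_gt0 ?mulr_gt0.
pose d' := Num.min d (Num.min (q / 2) (e * q ^+ 2 / (4 * (A + 1)))).
have A1 : 0 < A + 1 by rewrite ltr_wpDl.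
exists d'; first by rewrite !lt_min d0 !divr_gt0 ?mulr_gt0 ?exprn_gt0.
move=> w; rewrite !lt_min => /and3P[wd wq we].
have qw : q / 2 <= cn (w - z).
  have := cn_sub_le p z w; rewrite -/q (cnB p); lra.
have wz0 : w - z != 0 by rewrite -cn_gt0 (lt_le_trans _ qw) // divr_gt0.
rewrite -subr_eq0 (negbTE wz0) (negbTE pz).
pose r := g w - g p - l * (w - p).
have -> : (g w - c) / (w - z) - (g p - c) / (p - z) - (l - h) / (p - z) * (w - p) =
   r / (w - z) - (l - h) * (w - p) ^+ 2 / ((w - z) * (p - z)).
  by rewrite /h /r; field; rewrite wz0 pz0.
set D := cn (w - p) in wd wq we *; have D0 : 0 <= D := cn_ge0 _.
have B1 : cn (r / (w - z)) <= e / 2 * D.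
  rewrite cnM cnV ler_pdivrMr ?(lt_le_trans _ qw) ?divr_gt0 //.
  apply: le_trans (gd _ wd) _; rewrite -/D.
  apply: le_trans (_ : e / 2 * D * (q / 2) <= _).
    by rewrite le_eqVlt; apply/orP; left; apply/eqP; field.
  by rewrite ler_wpM2l // mulr_ge0 // divr_ge0 // ltW.
have B2 : cn ((l - h) * (w - p) ^+ 2 / ((w - z) * (p - z))) <= e / 2 * D.
  rewrite cnM cnV (cnM (w - z)) (cnM (l - h)) cnX -/A -/D -/q ler_pdivrMr; last first.
    by rewrite mulr_gt0 // (lt_le_trans _ qw) // divr_gt0.
  have AD : A * D <= e * q ^+ 2 / 4.
    apply: le_trans (_ : (A + 1) * D <= _); first by rewrite ler_wpM2r // lerDl.
    move: we; rewrite invfM mulrA ltr_pdivlMr // => /ltW; lra.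
  apply: le_trans (_ : e * q ^+ 2 / 4 * D <= _).
    by rewrite expr2 mulrA ler_wpM2r.
  apply: le_trans (_ : e / 2 * D * (q / 2 * q) <= _).
    by rewrite le_eqVlt; apply/orP; left; apply/eqP; field.
  by rewrite ler_wpM2l ?mulr_ge0 ?ler_wpM2r // ?divr_ge0 // ltW.
apply: le_trans (cnD _ _) _; rewrite cnN; lra.
Qed.

(** The value 0 at the singularity is a bounded default, as suits [triangle_star]. *)
Definition cquot g z w := if w == z then 0 else (g w - g z) / (w - z).

(** The square is cut into four triangles with apex z. Since |z| <= 1 / 2, each side lies in an open
    half plane bounded by a line through z, and the quotient is bounded: near z by differentiability
    of g at z, elsewhere by 2 M over the distance to z. Hence [triangle_star] applies to each
    piece. *)
Lemma sq_sum_cquot g (M : R) z : (forall w, cn w < 2 -> cdiff g w) ->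
  (forall w, cn w < 2 -> cn (g w) <= M) -> cn z <= 1 / 2 ->
  forall e, 0 < e -> exists N, forall n, (N <= n)%N -> cn (sq_sum n (cquot g z)) <= e.
Proof.
move=> dg gM z1.
have r2 w : cn w <= 3 / 2 -> cn w < 2 by lra.
have z32 : cn z <= 3 / 2 by lra.
have M0 : 0 <= M := le_trans (cn_ge0 _) (gM _ (r2 _ z32)).
have dh w : cn w <= 3 / 2 -> w != z -> cdiff (cquot g z) w.
  by move=> w1 wz; apply: cdiff_quot => //; apply/dg/r2.
have [m hm] : exists m, forall w, cn w <= 3 / 2 -> cn (cquot g z w) <= m.
  have [l gl] := dg _ (r2 _ z32); have [d d0 gd] := gl 1 ltr01.
  exists (cn l + 1 + 2 * M / d) => w w1; rewrite /cquot.
  have c0 := cn_ge0 l; have Md : 0 <= 2 * M / d by rewrite divr_ge0 ?mulr_ge0 // ltW.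
  case: eqVneq => [_|wz]; first by rewrite cn0; lra.
  have wz0 : 0 < cn (w - z) by rewrite cn_gt0 subr_eq0.
  rewrite cnM cnV ler_pdivrMr //; case: (ltP (cn (w - z)) d) => wd.
    apply: le_trans (cn_le_sub _ (l * (w - z))) _; rewrite cnM.
    apply: le_trans (lerD (lexx _) (gd _ wd)) _.
    by rewrite -mulrDl ler_wpM2r ?cn_ge0 // lerDl.
  apply: le_trans (_ : 2 * M / d * d <= _).
    rewrite divfK ?gt_eqF // (le_trans (cnD _ _)) // cnN mulr2n mulrDl mul1r.
    by rewrite lerD // gM // r2.
  apply: le_trans (_ : 2 * M / d * cn (w - z) <= _); first by rewrite ler_wpM2l.
  by rewrite ler_wpM2r ?cn_ge0 // lerDr addr_ge0.
have zl lam : cn lam = 1 -> `|complex.Re (lam * z)| <= 1 / 2.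
  by move=> l1; rewrite (le_trans (Re_le_cn _)) // cnM l1 mul1r.
have pos lam a : cn lam = 1 -> complex.Re (lam * a) = 1 -> 0 < complex.Re (lam * (a - z)).
  move=> l1 a1; have -> : lam * (a - z) = lam * a + - (lam * z) by ring.
  have := zl _ l1; rewrite ler_norml => /andP[_ h]; rewrite ReD a1.
  have -> : complex.Re (- (lam * z)) = - complex.Re (lam * z) by case: (lam * z).
  lra.
have [u1 u2 u3 u4] := cn_unit R.
have c1 := c1i R; have c2 := c1mi R; have c3 := cm1i R; have c4 := cm1mi R.
move=> e e0; have e40 : 0 < e / 4 by rewrite divr_gt0.
have S lam a b : cn lam = 1 -> cn a <= 3 / 2 -> cn b <= 3 / 2 ->
    complex.Re (lam * a) = 1 -> complex.Re (lam * b) = 1 ->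
    exists N, forall n, (N <= n)%N -> cn (tri_sum n (cquot g z) z a b) <= e / 4.
  by move=> l1 ar br a1 b1; apply: (triangle_star (lam := lam) dh hm) => //; apply: pos.
have [||N1 H1] := S 1 (1 - 'i) (1 + 'i) u1 c2 c1; [by rewrite /=; ring..|].
have [||N2 H2] := S (- 'i) (1 + 'i) (-1 + 'i) u2 c1 c3; [by rewrite /=; ring..|].
have [||N3 H3] := S (-1) (-1 + 'i) (-1 - 'i) u3 c3 c4; [by rewrite /=; ring..|].
have [||N4 H4] := S 'i (-1 - 'i) (1 - 'i) u4 c4 c2; [by rewrite /=; ring..|].
exists (N1 + N2 + N3 + N4)%N => n nn; have [n1 n2 n3 n4] := leq_sum4 nn.
move: (H1 _ n1) (H2 _ n2) (H3 _ n3) (H4 _ n4) => {}H1 {}H2 {}H3 {}H4.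
have -> : sq_sum n (cquot g z) = tri_sum n (cquot g z) z (1 - 'i) (1 + 'i) +
    tri_sum n (cquot g z) z (1 + 'i) (-1 + 'i) + tri_sum n (cquot g z) z (-1 + 'i) (-1 - 'i) +
    tri_sum n (cquot g z) z (-1 - 'i) (1 - 'i).
  rewrite /sq_sum /tri_sum (mid_sumN _ _ z (1 - 'i)) (mid_sumN _ _ z (1 + 'i)).
  by rewrite (mid_sumN _ _ z (-1 + 'i)) (mid_sumN _ _ z (-1 - 'i)); ring.
apply: le_trans (cnD _ _) _; apply: le_trans (lerD (cnD _ _) (lexx _)) _.
apply: le_trans (lerD (lerD (cnD _ _) (lexx _)) (lexx _)) _; lra.
Qed.

Definition sq_int phi := Ulim (fun n => sq_sum n phi).

(** The substitute for 2 pi i; [kappa_ge] keeps it away from 0. *)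
Definition kappa : C := sq_int (fun w => w^-1).

(** Cauchy's formula for the derivative at 0, taken as a functional on all bounded functions.
    Subtracting [phi 0] makes constants have derivative 0 by construction. *)
Definition cderiv phi : C := sq_int (fun w => (phi w - phi 0) / w ^+ 2) / kappa.

Lemma bounded_sq_sum_inv : bounded_seq (fun n => sq_sum n (fun w : C => w^-1)).
Proof.
exists (8 * 1) => n; apply: sq_sum_bound => w /andP[w1 _].
by rewrite cnV invf_le1 // (lt_le_trans _ w1).
Qed.

Lemma kappa_ge : 4 <= cn kappa.
Proof.
apply/ler_addgt0Pr => e e0; have [n] := filter_ex (Ulim_near bounded_sq_sum_inv e0).
move=> /ltW h; apply: le_trans (sq_sum_inv _ n) _.
by rewrite (le_trans (cn_le_sub _ kappa)) // lerD2l cnB.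
Qed.

Lemma ring_lt2 w : ring_set w -> cn w < 2.
Proof. by move=> /andP[_ h]; lra. Qed.

Lemma cnB_le z w (M : R) : cn z <= M -> cn w <= M -> cn (z - w) <= 2 * M.
Proof.
by move=> ? ?; rewrite (le_trans (cnD _ _)) // cnN mulr_natl mulr2n lerD.
Qed.

Lemma cderiv_seq phi (M : R) : (forall w, cn w < 2 -> cn (phi w) <= M) ->
  forall n, cn (sq_sum n (fun w => (phi w - phi 0) / w ^+ 2)) <= 16 * M.
Proof.
move=> phiM n; have -> : 16 * M = 8 * (2 * M) by ring.
apply: sq_sum_bound => w wr; have /andP[w1 _] := wr.
rewrite cnM cnV cnX ler_pdivrMr ?exprn_gt0 ?(lt_le_trans _ w1) //.
have p0 : cn (phi 0) <= M by apply: phiM; rewrite cn0.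
have M0 : 0 <= M := le_trans (cn_ge0 _) p0.
apply: le_trans (cnB_le (phiM _ (ring_lt2 wr)) p0) _.
by rewrite ler_peMr ?mulr_ge0 // exprn_ege1.
Qed.

Lemma cderiv_bound phi (M : R) : (forall w, cn w < 2 -> cn (phi w) <= M) ->
  cn (cderiv phi) <= 4 * M.
Proof.
move=> phiM; have k4 := kappa_ge.
have M0 : 0 <= M by apply: le_trans (cn_ge0 _) (phiM 0 _); rewrite cn0.
rewrite /cderiv cnM cnV ler_pdivrMr; last by lra.
apply: le_trans (Ulim_norm (cderiv_seq phiM)) _.
apply: le_trans (_ : 4 * M * 4 <= _); first by lra.
by rewrite ler_wpM2l // mulr_ge0.
Qed.

Lemma cderiv_lin phi psi (M N : R) z : (forall w, cn w < 2 -> cn (phi w) <= M) ->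
  (forall w, cn w < 2 -> cn (psi w) <= N) ->
  cderiv (fun w => z * phi w + psi w) = z * cderiv phi + cderiv psi.
Proof.
move=> phiM psiN; rewrite /cderiv mulrA -mulrDl; congr (_ / _).
have b1 : bounded_seq (fun n => sq_sum n (fun w => (phi w - phi 0) / w ^+ 2)).
  by exists (16 * M); apply: cderiv_seq.
have b2 : bounded_seq (fun n => sq_sum n (fun w => (psi w - psi 0) / w ^+ 2)).
  by exists (16 * N); apply: cderiv_seq.
rewrite /sq_int -UlimZ // -UlimD //; last exact: bounded_seqZ.
congr Ulim; apply/funext => n; rewrite -sq_sum_lin; congr (sq_sum n _).
by apply/funext => w; rewrite mulrA -mulrDl; congr (_ / _); ring.
Qed.

(** The sums of the two quotients [cquot g z] and [cquot g 0] tend to 0. Expanding their difference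
    on the contour by 1 / (w - z) = 1 / w + z / w^2 + z^2 / (w^2 (w - z)) gives, up to a vanishing
    error, De k = z x + z^2 y - De z t. As |k| >= 4, this bounds De linearly in z; that bound, put
    back into the term De z t, makes the remainder quadratic. *)
Theorem cauchy_second_order g (M : R) z : (forall w, cn w < 2 -> cdiff g w) ->
  (forall w, cn w < 2 -> cn (g w) <= M) -> cn z <= 1 / 2 ->
  cn (g z - g 0) <= 16 * M * cn z /\
  cn (g z - g 0 - z * cderiv g) <= 72 * M * cn z ^+ 2.
Proof.
move=> dg gM z1.
have g0M : cn (g 0) <= M by apply: gM; rewrite cn0.
have M0 : 0 <= M := le_trans (cn_ge0 _) g0M.
set De := g z - g 0; have Z0 := cn_ge0 z; set Z := cn z in z1 Z0 *.
have DeM : cn De <= 2 * M by apply: cnB_le g0M; apply: gM; rewrite -/Z; lra.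
pose x n := sq_sum n (fun w => (g w - g 0) / w ^+ 2).
pose k n := sq_sum n (fun w : C => w^-1).
pose y n := sq_sum n (fun w => (g w - g 0) / (w ^+ 2 * (w - z))).
pose t n := sq_sum n (fun w => (w * (w - z))^-1).
have wz w : ring_set w -> 1 / 2 <= cn (w - z).
  by move=> /andP[w1 _]; have := cn_ge_sub w z; rewrite -/Z; lra.
have yb n : cn (y n) <= 32 * M.
  rewrite (_ : 32 * M = 8 * (4 * M)); last by ring.
  apply: sq_sum_bound => w wr; have /andP[w1 _] := wr; have wzr := wz _ wr.
  have w2 : 1 <= cn w ^+ 2 by rewrite exprn_ege1.
  rewrite cnM cnV cnM cnX ler_pdivrMr; last by rewrite mulr_gt0 //; lra.
  apply: le_trans (cnB_le (gM _ (ring_lt2 wr)) g0M) _.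
  rewrite (_ : 2 * M = 4 * M * (1 * (1 / 2))); last by field.
  by rewrite ler_wpM2l ?mulr_ge0 // ler_pM.
have tb n : cn (t n) <= 16.
  rewrite (_ : 16 = 8 * 2); last by ring.
  apply: sq_sum_bound => w wr; have /andP[w1 _] := wr; have wzr := wz _ wr.
  have w0 : 0 < cn w * cn (w - z) by rewrite mulr_gt0 //; lra.
  rewrite cnV cnM -[leRHS]invrK lef_pV2 ?posrE // -[leLHS]mul1r ler_pM //; lra.
have xb n : cn (x n) <= 16 * M := cderiv_seq gM n; have k4 n : 4 <= cn (k n) := sq_sum_inv _ n.
have iden n : sq_sum n (cquot g z) - sq_sum n (cquot g 0) =
    z * x n + z ^+ 2 * y n - De * (k n + z * t n).
  have -> : z * x n + z ^+ 2 * y n - De * (k n + z * t n) =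
    z * x n + (z ^+ 2 * y n + (- De * k n + ((- De * z) * t n + 0 * t n))) by ring.
  have -> : sq_sum n (cquot g z) - sq_sum n (cquot g 0) =
    -1 * sq_sum n (cquot g 0) + sq_sum n (cquot g z) by ring.
  have zt : 0 * t n = sq_sum n (fun=> 0 : C).
    have := sq_sum_lin n (-1) (fun=> 0) (fun=> 0 : C).
    rewrite (_ : (fun=> _) = (fun=> 0 : C)); last by apply/funext => w; ring.
    by rewrite mul0r mulN1r addNr.
  rewrite zt /x /y /k /t -!sq_sum_lin; apply: sq_sum_ext => w wr.
  have /andP[w1 _] := wr; have wzr := wz _ wr.
  have w0 : w != 0 by rewrite -cn_gt0 (lt_le_trans _ w1).
  have wz0 : w - z != 0 by rewrite -cn_gt0 (lt_le_trans _ wzr).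
  rewrite /cquot (negbTE w0) -(subr_eq0 w z) (negbTE wz0) subr0 /De; field.
  by rewrite w0 wz0.
have z01 : cn (0 : C) <= 1 / 2 by rewrite cn0; lra.
have main e : 0 < e -> exists N, forall n, (N <= n)%N ->
    cn (z * x n + z ^+ 2 * y n - De * (k n + z * t n)) <= e.
  move=> e0; have e20 : 0 < e / 2 by rewrite divr_gt0.
  have [N1 H1] := sq_sum_cquot dg gM z1 e20.
  have [N2 H2] := sq_sum_cquot dg gM z01 e20.
  exists (N1 + N2)%N => n nn; rewrite -iden (le_trans (cnD _ _)) // cnN.
  rewrite [leRHS]splitr lerD //; [apply: H1|apply: H2].
    exact: leq_trans (leq_addr _ _) nn.
  exact: leq_trans (leq_addl _ _) nn.
have ZZ : Z ^+ 2 <= Z * (1 / 2) by rewrite expr2 ler_wpM2l.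
(* The three terms contribute 16, 16 and 32 times M Z, and 64 / 4 = 16. *)
have D1 : cn De <= 16 * M * Z.
  apply/ler_addgt0Pr => e e0; have [N HN] := main e e0; have {}HN := HN N (leqnn N).
  have E1 : De * k N = z * x N + z ^+ 2 * y N - De * z * t N -
     (z * x N + z ^+ 2 * y N - De * (k N + z * t N)) by ring.
  have : cn (De * k N) <= 64 * M * Z + e.
    rewrite E1; apply: le_trans (cnD _ _) _; rewrite cnN; apply: lerD => //.
    apply: le_trans (cnD _ _) _; rewrite cnN; apply: le_trans (lerD (cnD _ _) (lexx _)) _.
    rewrite (cnM z) (cnM (z ^+ 2)) cnX (cnM _ (t N)) (cnM De) -/Z.
    have a1 : Z * cn (x N) <= Z * (16 * M) by rewrite ler_wpM2l.
    have a2 : Z ^+ 2 * cn (y N) <= Z * (1 / 2) * (32 * M).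
      by rewrite ler_pM ?cn_ge0 // exprn_ge0.
    have a3 : cn De * Z * cn (t N) <= 2 * M * Z * 16.
      by rewrite ler_pM ?cn_ge0 ?mulr_ge0 ?cn_ge0 // ler_wpM2r.
    lra.
  rewrite cnM => h; have h4 : cn De * 4 <= cn De * cn (k N) by rewrite ler_wpM2l ?cn_ge0.
  lra.
split => //.
have kap0 : 0 < cn kappa by apply: lt_le_trans kappa_ge.
have bx : bounded_seq x by exists (16 * M).
have bk : bounded_seq k := bounded_sq_sum_inv.
have E2 : De - z * cderiv g = Ulim (fun n => De * k n + (- z) * x n) / kappa.
  rewrite UlimD ?UlimZ //; try exact: bounded_seqZ.
  rewrite -/(sq_int _) -/kappa /cderiv -/(sq_int _); field.
  by rewrite -cn_gt0.
rewrite E2 cnM cnV ler_pdivrMr //.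
(* The term in y gives 32 and the term in t gives 16 times 16 by [D1]; 32 + 256 = 72 times 4. *)
apply: le_trans (_ : 72 * M * Z ^+ 2 * 4 <= _); last first.
  by rewrite ler_wpM2l ?kappa_ge // !mulr_ge0 // exprn_ge0.
apply/ler_addgt0Pr => e e0; have [N HN] := main e e0.
rewrite -[Ulim _]subr0; apply: (@Ulim_le _ _ _ _ N).
  by apply: bounded_seqD; apply: bounded_seqZ.
move=> n /HN {}HN; rewrite subr0.
have -> : De * k n + - z * x n = z ^+ 2 * y n - De * z * t n -
     (z * x n + z ^+ 2 * y n - De * (k n + z * t n)) by ring.
apply: le_trans (cnD _ _) _; rewrite cnN; apply: lerD => //.
apply: le_trans (cnD _ _) _; rewrite cnN (cnM (z ^+ 2)) cnX (cnM _ (t n)) (cnM De) -/Z.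
have a2 : Z ^+ 2 * cn (y n) <= Z ^+ 2 * (32 * M) by rewrite ler_wpM2l ?exprn_ge0.
have a3 : cn De * Z * cn (t n) <= 16 * M * Z * Z * 16.
  by rewrite ler_pM ?cn_ge0 ?mulr_ge0 ?cn_ge0 // ler_wpM2r.
rewrite expr2 in a2 *; lra.
Qed.
End CauchyKey.

(** * Several variables *)

Section Vectors.
Variables (R : realType) (n : nat).
Local Notation C := (Cplx R).
Local Notation V := 'rV[C]_n.
Implicit Types (z u v w : V) (f g : V -> C) (L : V -> C).

(* The l^1 norm, with values in [R]. *)
Definition nv u : R := \sum_(i < n) cn (u 0 i).

Lemma nv_ge0 u : 0 <= nv u. Proof. by apply: sumr_ge0 => i _; exact: cn_ge0. Qed.

Lemma nv0 : nv 0 = 0.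
Proof. by rewrite /nv big1 // => i _; rewrite mxE cn0. Qed.

Lemma nvN u : nv (- u) = nv u.
Proof. by apply: eq_bigr => i _; rewrite mxE cnN. Qed.

Lemma nvB u v : nv (u - v) = nv (v - u). Proof. by rewrite -nvN opprB. Qed.

Lemma nvD u v : nv (u + v) <= nv u + nv v.
Proof. by rewrite /nv -big_split; apply: ler_sum => i _; rewrite mxE cnD. Qed.

Lemma nvZ c u : nv (c *: u) = cn c * nv u.
Proof. by rewrite /nv mulr_sumr; apply: eq_bigr => i _; rewrite mxE cnM. Qed.

Lemma cn_le_nv u i : cn (u 0 i) <= nv u.
Proof. by rewrite /nv (bigD1 i) //= lerDl sumr_ge0 // => j _; exact: cn_ge0. Qed.

Lemma nv_eq0 u : nv u = 0 -> u = 0.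
Proof.
move=> u0; apply/rowP => i; rewrite mxE; apply/eqP; rewrite -cn_eq0 eq_le cn_ge0 andbT.
by rewrite -u0 cn_le_nv.
Qed.

Definition lin L := forall c u v, L (c *: u + v) = c * L u + L v.

Lemma lin0 L : lin L -> L 0 = 0.
Proof. by move=> lL; have := lL (-1) 0 0; rewrite scaler0 addr0 mulN1r addNr. Qed.

Lemma linZ L c u : lin L -> L (c *: u) = c * L u.
Proof. by move=> lL; rewrite -[c *: u]addr0 lL lin0 // addr0. Qed.

Lemma linE L u : lin L -> L u = \sum_(i < n) u 0 i * L (delta_mx 0 i).
Proof.
move=> lL; rewrite {1}(row_sum_delta u).
have S : forall s : seq 'I_n, L (\sum_(i <- s) u 0 i *: delta_mx 0 i) =
    \sum_(i <- s) u 0 i * L (delta_mx 0 i).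
  elim=> [|i s IH]; first by rewrite !big_nil lin0.
  by rewrite !big_cons lL IH.
exact: S.
Qed.

Lemma lin_bound L : lin L -> exists2 B, 0 <= B & forall u, cn (L u) <= B * nv u.
Proof.
move=> lL; pose B := \sum_(i < n) cn (L (delta_mx 0 i)); exists B.
  by apply: sumr_ge0 => i _; exact: cn_ge0.
have S : forall (s : seq 'I_n) (F : 'I_n -> C), cn (\sum_(i <- s) F i) <= \sum_(i <- s) cn (F i).
  move=> s F; elim: s => [|i s IH]; first by rewrite !big_nil cn0.
  by rewrite !big_cons (le_trans (cnD _ _)) // lerD2l.
move=> u; rewrite (linE u lL); apply: le_trans (S _ _) _.
rewrite /B mulr_suml; apply: ler_sum => i _; rewrite cnM mulrC.
by rewrite ler_wpM2l ?cn_ge0 // cn_le_nv.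
Qed.

(* [isE] is Frechet differentiability; [isQ], with a quadratic remainder, is
   equivalent to it on open sets and more stable under algebraic operations. *)
Definition isE f z L := lin L /\ forall e : R, 0 < e -> exists2 d : R, 0 < d &
  forall u, nv u < d -> cn (f (z + u) - f z - L u) <= e * nv u.

Definition isQ f z L := lin L /\ exists d K : R, [/\ 0 < d, 0 <= K &
  forall u, nv u < d -> cn (f (z + u) - f z - L u) <= K * nv u ^+ 2].

Definition qdiff f z := exists L, isQ f z L.

(** The default makes [D f z] linear whatever f and z are, as [D_lin] records. *)
Definition D f z : V -> C := xget (fun=> 0) [set L | isQ f z L].

Lemma DP f z : qdiff f z -> isQ f z (D f z).
Proof. by move=> [L fL]; apply: (xgetPex (fun=> 0)); exists L. Qed.

Lemma D_lin f z : lin (D f z).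
Proof.
rewrite /D; case: (pselect (exists L, isQ f z L)) => [ex|nex].
  by have [] := xgetPex (fun=> 0) ex.
rewrite xgetPN => [c u v|L fL]; first by rewrite mulr0 addr0.
by apply: nex; exists L.
Qed.

Lemma isQE f z L : isQ f z L -> isE f z L.
Proof.
move=> [lL [d [K [d0 K0 fK]]]]; split => // e e0.
have K1 : 0 < K + 1 by rewrite ltr_wpDl.
exists (Num.min d (e / (K + 1))); first by rewrite lt_min d0 divr_gt0.
move=> u; rewrite lt_min => /andP[ud ue]; apply: le_trans (fK _ ud) _.
rewrite expr2 mulrA ler_wpM2r ?nv_ge0 //.
move: ue; rewrite ltr_pdivlMr // => /ltW; apply: le_trans.
by rewrite mulrC ler_wpM2l ?nv_ge0 // lerDl.
Qed.

Lemma isE_cdiff f z u (x : C) L : isE f (z + x *: u) L ->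
  cdiff (fun y => f (z + y *: u)) x.
Proof.
move=> [lL fL]; exists (L u) => e e0.
have u1 : 0 < nv u + 1 by rewrite ltr_wpDl ?nv_ge0.
have [|d d0 fd] := fL (e / (nv u + 1)); first by rewrite divr_gt0.
exists (d / (nv u + 1)); first by rewrite divr_gt0.
move=> y yd.
have yu : nv ((y - x) *: u) <= cn (y - x) * (nv u + 1).
  by rewrite nvZ ler_wpM2l ?cn_ge0 // lerDl.
have E : z + x *: u + (y - x) *: u = z + y *: u.
  by rewrite -addrA -scalerDl; congr (_ + _ *: _); ring.
have := fd ((y - x) *: u); rewrite E linZ // (mulrC (y - x)) => /(_ _)/le_trans; apply.
  by rewrite (le_lt_trans yu) // -ltr_pdivlMr.
apply: le_trans (ler_wpM2l _ yu) _; first by rewrite divr_ge0 // ltW.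
by rewrite mulrCA divfK ?gt_eqF // mulrC.
Qed.

(** On the complex line through z directed by u, f is differentiable and bounded for |y| < 2, so the
    one-variable estimates apply. The Cauchy derivative is identified with [L u] by comparing the
    two first order expansions at a small real y = t. *)
Lemma isE_line f z r (M : R) L u : 0 < r ->
  (forall v, nv v < r -> exists L, isE f (z + v) L) ->
  (forall v, nv v < r -> cn (f (z + v)) <= M) -> isE f z L -> 2 * nv u <= r ->
  [/\ cderiv (fun y => f (z + y *: u)) = L u, cn (L u) <= 4 * M &
  forall y, cn y <= 1 / 2 -> cn (f (z + y *: u) - f z) <= 16 * M * cn y /\
    cn (f (z + y *: u) - f z - y * L u) <= 72 * M * cn y ^+ 2].
Proof.
move=> r0 df fM fL ur; pose g y := f (z + y *: u).
have yr (y : C) : cn y < 2 -> nv (y *: u) < r.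
  move=> y2; have := nv_ge0 u; rewrite le_eqVlt nvZ => /predU1P[<-|u0].
    by rewrite mulr0.
  by apply: lt_le_trans ur; rewrite ltr_pM2r.
have dg y : cn y < 2 -> cdiff g y.
  by move=> /yr/df[L' fL']; apply: isE_cdiff fL'.
have gM y : cn y < 2 -> cn (g y) <= M by move=> /yr/fM.
have g0 : g 0 = f z by rewrite /g scale0r addr0.
have est y (y1 : cn y <= 1 / 2) := cauchy_second_order dg gM y1.
have cL : cderiv g = L u.
  apply/eqP; rewrite -subr_eq0 -cn_eq0 eq_le cn_ge0 andbT.
  apply/ler_addgt0Pr => e e0; rewrite add0r.
  have M0 : 0 <= M by apply: le_trans (cn_ge0 _) (gM 0 _); rewrite cn0.
  have u1 : 0 < nv u + 1 by rewrite ltr_wpDl ?nv_ge0.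
  have M1 : 0 < 72 * M + 1 by rewrite ltr_wpDl // mulr_ge0.
  have [lL /(_ (e / 2 / (nv u + 1)))[|d d0 fd]] := fL; first by rewrite !divr_gt0.
  (* The three bounds admit the expansion at t, put t u within d, and make the quadratic error at
     most t e / 2. *)
  pose t := Num.min (1 / 2) (Num.min (d / 2 / (nv u + 1)) (e / 2 / (72 * M + 1))).
  have t0 : 0 < t by rewrite !lt_min !divr_gt0.
  have [t1 t2 t3] : [/\ t <= 1 / 2, t <= d / 2 / (nv u + 1) & t <= e / 2 / (72 * M + 1)].
    by rewrite /t !ge_min !lexx !orbT.
  pose y : C := t%:C; have yt : cn y = t by rewrite cnr gtr0_norm.
  have yne : y != 0 by rewrite -cn_eq0 yt gt_eqF.
  have [|_] := est y; first by rewrite yt.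
  have := fd (y *: u); rewrite nvZ yt linZ // -/(g y) g0.
  have tu : t * nv u <= t * (nv u + 1) by rewrite ler_wpM2l ?lerDl // ltW.
  have tu2 : t * nv u < d.
    apply: le_lt_trans tu _; move: t2; rewrite ler_pdivlMr // => /le_lt_trans; apply.
    lra.
  move=> /(_ tu2) h1 h2.
  have h3 : cn (y * (cderiv g - L u)) <= e / 2 / (nv u + 1) * (t * nv u) + 72 * M * t ^+ 2.
    have -> : y * (cderiv g - L u) = (g y - f z - y * L u) - (g y - f z - y * cderiv g) by ring.
    by rewrite (le_trans (cnD _ _)) // cnN lerD.
  have h4 : e / 2 / (nv u + 1) * (t * nv u) <= t * (e / 2).
    apply: le_trans (ler_wpM2l _ tu) _; first by rewrite !divr_ge0 // ltW.
    by rewrite mulrCA divfK ?gt_eqF.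
  have h5 : 72 * M * t ^+ 2 <= t * (e / 2).
    rewrite (_ : 72 * M * t ^+ 2 = t * (72 * M * t)); last by ring.
    rewrite ler_wpM2l ?(ltW t0) //; move: t3; rewrite ler_pdivlMr // => /(le_trans _); apply.
    by rewrite mulrC ler_wpM2l ?lerDl ?(ltW t0).
  rewrite -(ler_pM2l t0); rewrite -{1}yt -cnM; apply: le_trans h3 _.
  apply: le_trans (lerD h4 h5) _; rewrite -mulrDr -splitr //.
split => //; first by rewrite -cL; exact: cderiv_bound.
by move=> y /est; rewrite -/(g y) g0 cL.
Qed.

(** Rescaling: u = y v with [nv v] = r / 2 and |y| = 2 [nv u] / r, so that [nv u <= r / 4] means |y|
    <= 1 / 2. *)
Lemma isE_cauchy f z r (M : R) L u : 0 < r ->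
  (forall v, nv v < r -> exists L, isE f (z + v) L) ->
  (forall v, nv v < r -> cn (f (z + v)) <= M) -> isE f z L ->
  cn (L u) <= 8 * M / r * nv u /\ (nv u <= r / 4 ->
  cn (f (z + u) - f z) <= 32 * M / r * nv u /\
  cn (f (z + u) - f z - L u) <= 72 * (4 * M) / r ^+ 2 * nv u ^+ 2).
Proof.
move=> r0 df fM fL; have [lL _] := fL.
have := nv_ge0 u; rewrite le_eqVlt => /predU1P[u0|u0].
  have -> : u = 0 by apply: nv_eq0.
  by rewrite lin0 // addr0 !subrr cn0 nv0 !mulr0 expr0n /= mulr0.
pose t := 2 * nv u / r; have t0 : 0 < t by rewrite divr_gt0 ?mulr_gt0.
pose y : C := t%:C; have yt : cn y = t by rewrite cnr gtr0_norm.
have yne : y != 0 by rewrite -cn_eq0 yt gt_eqF.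
pose v := y^-1 *: u; have uE : u = y *: v by rewrite /v scalerA divff // scale1r.
have nvv : 2 * nv v <= r.
  rewrite /v nvZ cnV yt /t invf_div le_eqVlt; apply/orP; left; apply/eqP.
  by field; rewrite gt_eqF.
have [_ Lv est] := isE_line r0 df fM fL nvv; split.
  rewrite {1}uE linZ // cnM yt; apply: le_trans (ler_wpM2l (ltW t0) Lv) _.
  by rewrite le_eqVlt; apply/orP; left; apply/eqP; rewrite /t; field; rewrite gt_eqF.
move=> ur; have [|e1 e2] := est y.
  by rewrite yt /t ler_pdivrMr //; lra.
rewrite -uE -linZ // -uE yt in e1 e2; split.
  apply: le_trans e1 _; rewrite le_eqVlt; apply/orP; left; apply/eqP.
  by rewrite /t; field; rewrite gt_eqF.
apply: le_trans e2 _; rewrite le_eqVlt; apply/orP; left; apply/eqP.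
by rewrite /t; field; rewrite gt_eqF.
Qed.

Definition nopen (Om : set V) := forall z, Om z ->
  exists2 r : R, 0 < r & forall u, nv u < r -> Om (z + u).

Lemma isE_locally_bounded f z L : isE f z L -> exists r M : R, 0 < r /\
  forall u, nv u < r -> cn (f (z + u)) <= M.
Proof.
move=> [lL /(_ 1 ltr01)[d d0 fd]]; have [B B0 LB] := lin_bound lL.
exists (Num.min d 1), (cn (f z) + B + 1); rewrite lt_min d0 ltr01; split=> // u.
rewrite lt_min => /andP[/fd h u1].
have -> : f (z + u) = f z + L u + (f (z + u) - f z - L u) by ring.
apply: le_trans (cnD _ _) _; apply: lerD; last by rewrite (le_trans h) // mul1r ltW.
apply: le_trans (cnD _ _) _; rewrite lerD2l (le_trans (LB _)) // ler_piMr // ltW //.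
Qed.

Lemma isE_qdiff (Om : set V) f : nopen Om -> (forall z, Om z -> exists L, isE f z L) ->
  forall z, Om z -> qdiff f z.
Proof.
move=> oOm df z Oz; have [L fL] := df _ Oz; exists L.
have [r1 [M [r10 fM]]] := isE_locally_bounded fL; have [r2 r20 Or2] := oOm _ Oz.
have [lL _] := fL; split => //; pose r := Num.min r1 r2.
have r0 : 0 < r by rewrite lt_min r10 r20.
have fMr v : nv v < r -> cn (f (z + v)) <= M by rewrite lt_min => /andP[/fM].
have M0 : 0 <= M by apply: le_trans (cn_ge0 _) (fMr 0 _); rewrite nv0.
exists (r / 4), (72 * (4 * M) / r ^+ 2); split.
- by rewrite divr_gt0.
- by apply: divr_ge0; [do 2!apply: mulr_ge0 => //|apply: exprn_ge0; exact: ltW].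
- move=> u /ltW ur; have [|_ /(_ ur)[]//] := isE_cauchy u r0 _ fMr fL.
  by move=> v; rewrite lt_min => /andP[_ /Or2/df].
Qed.

Definition ballq f z r (M : R) := forall v, nv v < r -> qdiff f (z + v) /\ cn (f (z + v)) <= M.

Lemma ballqS f z r (M : R) v s : ballq f z r M -> nv v + s <= r -> ballq f (z + v) s M.
Proof.
move=> h vs u us; rewrite -addrA; apply: h.
by apply: le_lt_trans (nvD _ _) _; lra.
Qed.

Lemma D_cauchy f z r (M : R) u : 0 < r -> ballq f z r M ->
  cn (D f z u) <= 8 * M / r * nv u /\ (nv u <= r / 4 ->
  cn (f (z + u) - f z) <= 32 * M / r * nv u /\
  cn (f (z + u) - f z - D f z u) <= 72 * (4 * M) / r ^+ 2 * nv u ^+ 2).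
Proof.
move=> r0 h; apply: isE_cauchy => //.
- by move=> v /h[/DP/isQE] q _; exists (D f (z + v)).
- by move=> v /h[].
- have [|/DP/isQE + _] := h 0; first by rewrite nv0.
  by rewrite addr0.
Qed.

Lemma D_line f z r (M : R) u : 0 < r -> ballq f z r M -> 2 * nv u <= r ->
  D f z u = cderiv (fun y => f (z + y *: u)).
Proof.
move=> r0 h ur; have [||||-> //] := @isE_line f z r M (D f z) u r0 => //.
- by move=> v /h[/DP/isQE] q _; exists (D f (z + v)).
- by move=> v /h[].
- have [|/DP/isQE + _] := h 0; first by rewrite nv0.
  by rewrite addr0.
Qed.

Lemma qdiff_ballq (Om : set V) f z : nopen Om -> (forall z, Om z -> qdiff f z) -> Om z ->
  exists r M : R, 0 < r /\ ballq f z r M.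
Proof.
move=> oOm df Oz; have /DP/isQE fL := df _ Oz.
have [r1 [M [r10 fM]]] := isE_locally_bounded fL; have [r2 r20 Or2] := oOm _ Oz.
exists (Num.min r1 r2), M; rewrite lt_min r10 r20; split => // v.
by rewrite lt_min => /andP[/fM ? /Or2/df].
Qed.

(* The derivative of [f] in direction [v] is a Cauchy integral of [f] along
   [v], and integrating the first order expansions of [f] at the points of the
   contour yields a first order expansion of that derivative. *)
Lemma qdiff_D (Om : set V) f v : nopen Om -> (forall z, Om z -> qdiff f z) ->
  forall z, Om z -> qdiff (fun z => D f z v) z.
Proof.
move=> oOm df z Oz; have [r [M [r0 h]]] := qdiff_ballq oOm df Oz.
have M0 : 0 <= M.
  by have [|_ /(le_trans (cn_ge0 _))//] := h 0; rewrite nv0.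
have v1 : 0 < nv v + 1 by rewrite ltr_wpDl ?nv_ge0.
(* The direction is rescaled to [nv w <= r / 4], so that the points z + y w with |y| < 2 keep a ball
   of radius r / 2 inside the ball around z. *)
pose t := 4 * (nv v + 1) / r; have t0 : 0 < t by rewrite divr_gt0 ?mulr_gt0.
pose s : C := t%:C; have st : cn s = t by rewrite cnr gtr0_norm.
have sne : s != 0 by rewrite -cn_eq0 st gt_eqF.
pose w := s^-1 *: v; have vE : v = s *: w by rewrite /w scalerA divff // scale1r.
have nw : 2 * nv w <= r / 2.
  suff : nv w <= r / 4 by lra.
  rewrite /w nvZ cnV st /t invf_div mulrAC ler_pdivrMr ?mulr_gt0 //.
  have -> : r / 4 * (4 * (nv v + 1)) = r * nv v + r by field.
  by rewrite lerDl ltW.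
have yw (y : C) : cn y < 2 -> nv (y *: w) + r / 2 <= r.
  move=> y2; have : nv (y *: w) <= 2 * nv w by rewrite nvZ ler_wpM2r ?nv_ge0 // ltW.
  lra.
have r20 : 0 < r / 2 by rewrite divr_gt0.
have hy (y : C) : cn y < 2 -> ballq f (z + y *: w) (r / 2) M.
  by move=> /yw; apply: ballqS.
pose L u := s * cderiv (fun y => D f (z + y *: w) u).
have bD u (y : C) : cn y < 2 -> cn (D f (z + y *: w) u) <= 8 * M / (r / 2) * nv u.
  by move=> /hy hy2; have [] := D_cauchy u r20 hy2.
exists L; split.
  move=> c u u'; rewrite /L.
  rewrite (_ : (fun y => _) = (fun y => c * D f (z + y *: w) u + D f (z + y *: w) u')).
    by rewrite (cderiv_lin _ (bD u) (bD u')); ring.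
  by apply/funext => y; rewrite D_lin.
exists (r / 8), (t * (4 * (72 * (4 * M) / (r / 2) ^+ 2))); split.
- by rewrite divr_gt0.
- apply: mulr_ge0; first exact: ltW.
  apply: mulr_ge0 => //; apply: divr_ge0; last by apply: exprn_ge0; exact: ltW.
  by do 2!apply: mulr_ge0 => //.
move=> u ur; have hu : ballq f (z + u) (r / 2) M by apply: ballqS h _; lra.
have h0 : ballq f z (r / 2) M.
  by rewrite -[z]addr0; apply: ballqS h _; rewrite nv0; lra.
rewrite vE !(linZ s w (@D_lin f _)) (D_line r20 hu nw) (D_line r20 h0 nw) /L.
rewrite -!mulrBr cnM st -mulrA ler_wpM2l ?(ltW t0) // -mulrA.
have fb (y : C) : cn y < 2 -> cn (f (z + y *: w)) <= M.
  by move=> /hy/(_ 0); rewrite nv0 addr0 => /(_ r20)[].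
have fbu (y : C) : cn y < 2 -> cn (f (z + u + y *: w)) <= M.
  by move=> /hy/(_ u); rewrite addrAC; case=> //; lra.
pose E y := f (z + u + y *: w) - f (z + y *: w) - D f (z + y *: w) u.
have bE (y : C) : cn y < 2 -> cn (E y) <= 72 * (4 * M) / (r / 2) ^+ 2 * nv u ^+ 2.
  move=> /hy hy2; have [_] := D_cauchy u r20 hy2.
  by rewrite /E (addrAC z u); case=> //; lra.
have -> : cderiv (fun y => f (z + u + y *: w)) =
   1 * cderiv (fun y => f (z + y *: w)) + (1 * cderiv (fun y => D f (z + y *: w) u) + cderiv E).
  rewrite -(cderiv_lin 1 (bD u) bE) -(cderiv_lin 1 fb (N := 8 * M / (r / 2) * nv u +
     72 * (4 * M) / (r / 2) ^+ 2 * nv u ^+ 2)).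
    by congr cderiv; apply/funext => y; rewrite /E; ring.
  by move=> y y2; rewrite mul1r (le_trans (cnD _ _)) // lerD ?bD ?bE.
set a := cderiv _; set b := cderiv (fun y => D _ _ _).
rewrite (_ : _ - _ = cderiv E); last by ring.
by apply: le_trans (cderiv_bound bE) _; rewrite mulrA.
Qed.

Lemma qdiff_cst c z : qdiff (fun=> c) z.
Proof.
exists (fun=> 0); split; first by move=> *; rewrite mulr0 addr0.
by exists 1, 0; split => // u _; rewrite subrr subr0 cn0 mul0r.
Qed.

Lemma qdiff_coord i z : qdiff (fun z => z 0 i) z.
Proof.
exists (fun u => u 0 i); split; first by move=> *; rewrite !mxE.
by exists 1, 0; split => // u _; rewrite mxE (addrC (z 0 i)) addrK subrr cn0 mul0r.
Qed.

Lemma qdiffD f g z : qdiff f z -> qdiff g z -> qdiff (fun z => f z + g z) z.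
Proof.
move=> [L [lL [d [K [d0 K0 fK]]]]] [L' [lL' [d' [K' [d0' K0' fK']]]]].
exists (fun u => L u + L' u); split; first by move=> c u v; rewrite lL lL'; ring.
exists (Num.min d d'), (K + K'); split; rewrite ?addr_ge0 ?lt_min ?d0 //.
move=> u; rewrite lt_min => /andP[/fK h /fK' h'].
rewrite mulrDl; apply: le_trans (lerD h h'); apply: le_trans (cnD _ _).
by rewrite le_eqVlt; apply/orP; left; apply/eqP; congr cn; ring.
Qed.

Lemma qdiffM f g z : qdiff f z -> qdiff g z -> qdiff (fun z => f z * g z) z.
Proof.
move=> [L [lL [d [K [d0 K0 fK]]]]] [L' [lL' [d' [K' [d0' K0' fK']]]]].
have [B B0 LB] := lin_bound lL; have [B' B0' LB'] := lin_bound lL'.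
exists (fun u => f z * L' u + g z * L u); split.
  by move=> c u v; rewrite lL lL'; ring.
have f0 := cn_ge0 (f z); have g0 := cn_ge0 (g z).
exists (Num.min 1 (Num.min d d')), (K * (cn (g z) + B' + K') + (cn (f z) + B) * K' + B * B').
split; rewrite ?lt_min ?d0 ?ltr01 //; first by rewrite !addr_ge0 ?mulr_ge0 ?addr_ge0.
move=> u; rewrite !lt_min => /and3P[u1 /fK h /fK' h'].
have u0 := nv_ge0 u; have u2 : nv u ^+ 2 <= 1 by rewrite expr_le1 // ltW.
have -> : f (z + u) * g (z + u) - f z * g z - (f z * L' u + g z * L u) =
  (f (z + u) - f z - L u) * (g z + L' u + (g (z + u) - g z - L' u)) +
  (f z + L u) * (g (z + u) - g z - L' u) + L u * L' u by ring.
have l1 : cn (L u) <= B by rewrite (le_trans (LB _)) // ler_piMr // ltW.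
have l2 : cn (L' u) <= B' by rewrite (le_trans (LB' _)) // ler_piMr // ltW.
set N := nv u ^+ 2 in h h' u2 *.
rewrite (_ : (K * _ + _ + _) * N = K * N * (cn (g z) + B' + K') +
  (cn (f z) + B) * (K' * N) + B * B' * N); last by ring.
apply: le_trans (cnD _ _) _; apply: lerD; last first.
  by rewrite cnM /N expr2 mulrACA ler_pM ?cn_ge0.
apply: le_trans (cnD _ _) _; rewrite !cnM; apply: lerD.
  rewrite ler_pM ?cn_ge0 //.
  apply: le_trans (cnD _ _) _; apply: lerD.
    by apply: le_trans (cnD _ _) _; rewrite lerD.
  by rewrite (le_trans h') // ler_piMr.
by rewrite ler_pM ?cn_ge0 // (le_trans (cnD _ _)) // lerD.
Qed.

Lemma qdiff_sum (I : Type) (s : seq I) (F : I -> V -> C) z :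
  (forall i, qdiff (F i) z) -> qdiff (fun z => \sum_(i <- s) F i z) z.
Proof.
move=> dF; elim: s => [|i s IH].
  rewrite (_ : (fun z => _) = (fun=> 0)); first exact: qdiff_cst.
  by apply/funext => w; rewrite big_nil.
rewrite (_ : (fun z => _) = (fun z => F i z + \sum_(i <- s) F i z)); first exact: qdiffD.
by apply/funext => w; rewrite big_cons.
Qed.

(** The derivative of f along F. In coordinates it is a sum of products of differentiable functions,
    which gives [qdiff_Lie]; [LieE] is the invariant form. *)
Definition Lie (F : V -> V) f z : C := \sum_(i < n) F z 0 i * D f z (delta_mx 0 i).

Lemma LieE F f z : Lie F f z = D f z (F z).
Proof. by rewrite (linE _ (@D_lin f z)). Qed.

Lemma qdiff_Lie (Om : set V) (F : V -> V) f : nopen Om -> (forall z, Om z -> qdiff f z) ->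
  (forall z i, Om z -> qdiff (fun z => F z 0 i) z) ->
  forall z, Om z -> qdiff (Lie F f) z.
Proof.
move=> oOm df dF z Oz; apply: qdiff_sum => i; apply: qdiffM; first exact: dF.
exact: qdiff_D oOm df _ Oz.
Qed.

End Vectors.

(** * Lie series along curves and analytic continuation of approximability *)

Section Continuation.
Variables (R : realType) (n : nat).
Local Notation C := (Cplx R).
Local Notation V := 'rV[C]_n.
Implicit Types (z u v w : V) (f g p q phi psi : V -> C) (t s h : R).

(** The inequality (1 + 1 / k)^k <= e in inverted form, with 0^0 = 1 at k = 0. *)
Lemma exp1_ge k : (expR 1)^-1 <= (k%:R / k.+1%:R) ^+ k :> R.
Proof.
case: k => [|k]; first by rewrite expr0 invf_le1 ?expR_gt0 // -expR0 ler_expR.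
have k0 : 0 < k.+1%:R :> R by rewrite ltr0n.
have -> : k.+1%:R / k.+2%:R = (1 + k.+1%:R^-1)^-1 :> R.
  by rewrite -[k.+2]addn1 natrD; field; rewrite !gt_eqF // ltr_wpDl // ltW.
have a0 : 0 < 1 + k.+1%:R^-1 :> R by rewrite ltr_pwDl // invr_ge0 ltW.
rewrite exprVn lef_pV2 ?posrE ?expR_gt0 ?exprn_gt0 //.
have -> : expR 1 = expR (k.+1%:R^-1) ^+ k.+1 :> R.
  by rewrite -expRM_natl mulfV ?gt_eqF.
by rewrite lerXn2r ?nnegrE ?expR_ge0 ?(ltW a0) // expR_ge1Dx.
Qed.

(* Cauchy's estimate is used on balls of radius [d / (k + 1)], where [d] is the
   distance to the boundary, so that the loss at each step is bounded by a
   factor [(1 + 1 / k) ^ k <= e]. *)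
Lemma Lie_iter_bound (F : V -> V) f z (r M MF : R) : 0 < r -> 0 <= MF ->
  (forall k u, nv u < r -> qdiff (iter k (Lie F) f) (z + u)) ->
  (forall u, nv u < r -> cn (f (z + u)) <= M) ->
  (forall u, nv u < r -> nv (F (z + u)) <= MF) ->
  forall k, cn (iter k (Lie F) f z) <= M * (8 * expR 1 * MF / r) ^+ k * k`!%:R.
Proof.
move=> r0 MF0 dq fM FM k; have E0 := expR_gt0 (1 : R).
have M0 : 0 <= M by apply: le_trans (cn_ge0 _) (fM 0 _); rewrite nv0.
pose A := 8 * expR 1 * MF; have A0 : 0 <= A by rewrite !mulr_ge0 // ltW.
(* The induction needs a bound on the whole ball, weighted by the distance r - [nv u] to its
   boundary. *)
suff H : forall u, nv u < r ->
    cn (iter k (Lie F) f (z + u)) <= M * A ^+ k * k`!%:R / (r - nv u) ^+ k.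
  have := H 0; rewrite nv0 addr0 subr0 => /(_ r0)/le_trans; apply.
  by rewrite expr_div_n -/A le_eqVlt; apply/orP; left; apply/eqP; ring.
elim: k => [|k IH] u ur; first by rewrite !expr0 fact0 divr1 !mulr1 fM.
rewrite iterS; set g := iter k (Lie F) f in IH *.
pose d := r - nv u; have d0 : 0 < d by rewrite subr_gt0.
have k0 : 0 < k.+1%:R :> R by rewrite ltr0n.
pose rho := d / k.+1%:R; have rho0 : 0 < rho by rewrite divr_gt0.
have rd : rho <= d by rewrite ler_pdivrMr // ler_peMr ?(ltW d0) ?ler1n.
pose B := M * A ^+ k * k`!%:R * expR 1 / d ^+ k.
have hB : ballq g (z + u) rho B.
  move=> v vr; rewrite -addrA.
  have uv : nv (u + v) < r by apply: le_lt_trans (nvD _ _) _; rewrite /d in rd; lra.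
  split; first exact: dq.
  apply: le_trans (IH _ uv) _; rewrite /B -[leRHS]mulrA; apply: ler_wpM2l.
    by rewrite !mulr_ge0 // exprn_ge0.
  have uv0 : 0 < r - nv (u + v) by rewrite subr_gt0.
  rewrite ler_pdivlMr ?exprn_gt0 // mulrC ler_pdivrMr ?exprn_gt0 //.
  have q : d * (k%:R / k.+1%:R) <= r - nv (u + v).
    have -> : d * (k%:R / k.+1%:R) = d - rho.
      by rewrite /rho -[k.+1]addn1 natrD; field; rewrite -natr1 in k0; rewrite gt_eqF.
    have := nvD u v; rewrite /d; lra.
  apply: le_trans (_ : expR 1 * (d * (k%:R / k.+1%:R)) ^+ k <= _); last first.
    rewrite ler_wpM2l ?expR_ge0 // lerXn2r ?nnegrE ?(ltW uv0) //.
    by rewrite mulr_ge0 ?(ltW d0) // divr_ge0 // ler0n.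
  rewrite exprMn mulrCA ler_peMr ?exprn_ge0 ?(ltW d0) //.
  by have := exp1_ge k; rewrite -ler_pdivrMl // mulr1.
have [h _] := D_cauchy (F (z + u)) rho0 hB.
rewrite LieE; apply: le_trans h _.
have B0 : 0 <= B by apply: le_trans (cn_ge0 _) (hB 0 _).2; rewrite nv0.
apply: le_trans (ler_wpM2l _ (FM _ ur)) _.
  by apply: divr_ge0; [exact: mulr_ge0|exact: ltW].
rewrite /B /rho factS natrM le_eqVlt; apply/orP; left; apply/eqP.
by rewrite -/d /A !exprS; field; rewrite !gt_eqF ?exprn_gt0.
Qed.

Definition cder (v : R -> C) t (l : C) := forall e : R, 0 < e ->
  exists2 d : R, 0 < d & forall h, `|h| < d -> cn (v (t + h) - v t - h%:C * l) <= e * `|h|.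

Definition nder (x : R -> V) t w := forall e : R, 0 < e ->
  exists2 d : R, 0 < d & forall h, `|h| < d -> nv (x (t + h) - x t - (h%:C : C) *: w) <= e * `|h|.

Lemma nder_lip (x : R -> V) t w : nder x t w ->
  exists2 d : R, 0 < d & forall h, `|h| < d -> nv (x (t + h) - x t) <= (nv w + 1) * `|h|.
Proof.
move=> /(_ 1 ltr01)[d d0 xd]; exists d => // h /xd hh.
rewrite -[x (t + h) - x t](subrK ((h%:C : C) *: w)) (le_trans (nvD _ _)) // nvZ cnr; lra.
Qed.

Lemma nder_comp f (x : R -> V) t w : nder x t w -> qdiff f (x t) ->
  cder (fun s => f (x s)) t (D f (x t) w).
Proof.
move=> dx /DP[lL [d [K [d0 K0 fK]]]] e e0; set L := D f (x t) in lL fK *.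
have [B B0 LB] := lin_bound lL; have [d1 d10 x1] := nder_lip dx.
have w1 : 0 < nv w + 1 by rewrite ltr_wpDl ?nv_ge0.
have B1 : 0 < B + 1 by rewrite ltr_wpDl.
have [|d2 d20 x2] := dx (e / 2 / (B + 1)); first by rewrite !divr_gt0.
have K1 : 0 < K * (nv w + 1) ^+ 2 + 1 by rewrite ltr_wpDl // mulr_ge0 // exprn_ge0 // ltW.
exists (Num.min (Num.min d1 d2)
   (Num.min (d / (nv w + 1)) (e / 2 / (K * (nv w + 1) ^+ 2 + 1)))).
  by rewrite !lt_min d10 d20 !divr_gt0.
move=> h; rewrite !lt_min => /andP[/andP[h1 h2] /andP[h3 h4]].
set De := x (t + h) - x t.
have xE : x (t + h) = x t + De by rewrite /De (addrC (x t)) subrK.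
have De1 : nv De <= (nv w + 1) * `|h| := x1 _ h1.
have De2 : nv De < d by apply: le_lt_trans De1 _; rewrite mulrC -ltr_pdivlMr.
have -> : f (x (t + h)) - f (x t) - h%:C * L w =
  (f (x t + De) - f (x t) - L De) + L (De - (h%:C : C) *: w).
  rewrite xE (_ : De - _ = (- h%:C : C) *: w + De); last by rewrite scaleNr addrC.
  by rewrite lL; ring.
have r1 : cn (f (x t + De) - f (x t) - L De) <= e / 2 * `|h|.
  apply: le_trans (fK _ De2) _.
  apply: le_trans (_ : K * ((nv w + 1) * `|h|) ^+ 2 <= _).
    by rewrite ler_wpM2l // lerXn2r ?nnegrE ?nv_ge0 // mulr_ge0 // ltW.
  rewrite exprMn (expr2 `|h|) !mulrA ler_wpM2r //.
  move: h4; rewrite ltr_pdivlMr // => /ltW; apply: le_trans.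
  rewrite (_ : K * _ * _ = K * (nv w + 1) ^+ 2); last by ring.
  by rewrite mulrC ler_wpM2l // lerDl.
have r2 : cn (L (De - (h%:C : C) *: w)) <= e / 2 * `|h|.
  apply: le_trans (LB _) _; apply: le_trans (ler_wpM2l B0 (x2 _ h2)) _.
  rewrite mulrA ler_wpM2r // mulrCA ler_piMr ?divr_ge0 ?(ltW e0) //.
  by rewrite ler_pdivrMr // mul1r lerDl.
apply: le_trans (cnD _ _) _; lra.
Qed.

(** The supremum of the c such that P holds on [a, c] satisfies P by the third hypothesis and, if
    below b, is exceeded by the second. This takes the place of integration in [mvi] and
    [gronwall]. *)
Lemma real_induction (P : R -> Prop) (a b : R) : P a ->
  (forall t, a <= t < b -> P t -> exists2 d : R, 0 < d & forall s, t < s < t + d -> P s) ->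
  (forall t, a < t <= b -> (forall s, a <= s < t -> P s) -> P t) ->
  forall t, a <= t <= b -> P t.
Proof.
move=> Pa Pr Pl t /andP[at_ tb].
pose S := [set c | a <= c <= b /\ forall s, a <= s <= c -> P s].
have Sa : S a.
  split=> [|s /andP[? ?]]; first by rewrite lexx (le_trans at_).
  by rewrite (_ : s = a) //; apply/eqP; rewrite eq_le; apply/andP.
have hS : has_sup S by split; [exists a|exists b => c [/andP[]]].
have cb : sup S <= b by apply: ge_sup => [|c [/andP[]]]; first by exists a.
have ac : a <= sup S by apply: ub_le_sup Sa; case: hS.
have Plt s : a <= s < sup S -> P s.
  move=> /andP[as_ sS]; have [|c [_ Pc] sc] := @sup_adherent _ S (sup S - s) _ hS.
    by rewrite subr_gt0.
  by apply: Pc; rewrite as_ ltW // (_ : s = sup S - (sup S - s)) //; ring.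
have Pc : P (sup S).
  move: ac; rewrite le_eqVlt => /predU1P[<- //|ac].
  by apply: Pl; rewrite ?ac ?cb.
have [tc|ct] := leP t (sup S).
  move: tc; rewrite le_eqVlt => /predU1P[-> //|tc]; apply: Plt; by rewrite at_.
have [|d d0 Pd] := Pr (sup S) _ Pc; first by rewrite ac (lt_le_trans ct).
exfalso; pose c := Num.min t (sup S + d / 2).
have c1 : sup S < c by rewrite lt_min ct ltrDl divr_gt0.
have : S c; last by move/(ub_le_sup hS.2); rewrite leNgt c1.
split; first by rewrite (le_trans ac (ltW c1)) ge_min tb.
move=> s /andP[as_ sc]; case: (ltgtP s (sup S)) => [sS|Ss|->] //.
  by apply: Plt; rewrite as_.
apply: Pd; rewrite Ss (le_lt_trans sc) // (@le_lt_trans _ _ (sup S + d / 2)) //.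
  by rewrite ge_min lexx orbT.
lra.
Qed.

Lemma cder_lip (v : R -> C) t l : cder v t l ->
  exists2 d : R, 0 < d & forall h, `|h| < d -> cn (v (t + h) - v t) <= (cn l + 1) * `|h|.
Proof.
move=> /(_ 1 ltr01)[d d0 xd]; exists d => // h /xd hh.
rewrite -[v (t + h) - v t](subrK (h%:C * l)) (le_trans (cnD _ _)) // cnM cnr; lra.
Qed.

(** A complex curve has no mean value point, so the bound is propagated by real induction; the slope
    m + e1 leaves room for the error in the definition of the derivative. *)
Lemma mvi (v v' : R -> C) (a b m : R) : a <= b ->
  (forall t, a <= t <= b -> cder v t (v' t) /\ cn (v' t) <= m) ->
  cn (v b - v a) <= m * (b - a).
Proof.
move=> ab dv; apply/ler_addgt0Pr => e e0.
have m0 : 0 <= m by apply: le_trans (cn_ge0 _) (dv a _).2; rewrite lexx.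
have ba1 : 0 < b - a + 1 by rewrite ltr_wpDl // subr_ge0.
pose e1 := e / (b - a + 1); have e10 : 0 < e1 by rewrite divr_gt0.
suff H : forall t, a <= t <= b -> cn (v t - v a) <= (m + e1) * (t - a).
  have := H b; rewrite ab lexx => /(_ isT)/le_trans; apply.
  rewrite mulrDl lerD2l /e1 mulrAC ler_pdivrMr // ler_wpM2l ?(ltW e0) // lerDl //.
apply: (@real_induction _ a b).
- by rewrite !subrr cn0 mulr0.
- move=> t /andP[at_ tb] Pt; have [|dt mt] := dv t; first by rewrite at_ ltW.
  have [d d0 hd] := dt _ e10; exists d => // s /andP[ts sd].
  have st0 : 0 <= s - t by rewrite subr_ge0 ltW.
  have := hd (s - t); rewrite ger0_norm // [t + _]addrC subrK ltrBlDl => /(_ sd) hh.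
  have -> : v s - v a = (v s - v t - (s - t)%:C * v' t) + (v t - v a) + (s - t)%:C * v' t by ring.
  apply: le_trans (cnD _ _) _; apply: le_trans (lerD (cnD _ _) (lexx _)) _.
  rewrite cnM cnr ger0_norm //; have := ler_wpM2l st0 mt; lra.
- move=> t /andP[at_ tb] Pt; have [|/cder_lip[d d0 hd] _] := dv t; first by rewrite ltW.
  set l := cn (v' t) + 1 in hd; have l0 : 0 < l by rewrite ltr_wpDl ?cn_ge0.
  apply/ler_addgt0Pr => e' e'0.
  pose k := Num.min (Num.min (t - a) (d / 2)) (e' / l).
  have k0 : 0 < k by rewrite !lt_min subr_gt0 at_ !divr_gt0.
  have [k1 k2 k3] : [/\ k <= t - a, k <= d / 2 & k <= e' / l].
    by rewrite /k !ge_min !lexx !orbT.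
  have := Pt (t - k); have := hd (- k); rewrite normrN gtr0_norm // => h1 h2.
  have h3 : cn (v (t - k) - v t) <= e'.
    by apply: le_trans (h1 _) _; [lra|rewrite mulrC -ler_pdivlMr].
  have h4 : cn (v (t - k) - v a) <= (m + e1) * (t - a).
    apply: le_trans (h2 _) _; first by apply/andP; split; lra.
    rewrite ler_wpM2l ?addr_ge0 ?(ltW e10) //; lra.
  apply: le_trans (cn_sub_le _ _ (v (t - k))) _; rewrite cnB addrC; lra.
Qed.

Lemma cder_const_lin (v : R -> C) t s l c : cder v t l ->
  cder (fun t => v t - (t - s)%:C * c) t (l - c).
Proof.
move=> dv e /dv[d d0 hd]; exists d => // h /hd; apply: le_trans.
rewrite le_eqVlt; apply/orP; left; apply/eqP; congr cn.
by rewrite (_ : t + h - s = (t - s) + h) ?rmorphD /=; ring.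
Qed.

(** [mvi] applied to v minus its tangent at a, whose derivative v' t - v' a is bounded by [mvi]
    again. *)
Lemma taylor2 (v v' v'' : R -> C) (a b m : R) : a <= b ->
  (forall t, a <= t <= b -> [/\ cder v t (v' t), cder v' t (v'' t) & cn (v'' t) <= m]) ->
  cn (v b - v a - (b - a)%:C * v' a) <= m * (b - a) ^+ 2.
Proof.
move=> ab dv.
have m0 : 0 <= m by have [|_ _] := dv a; [rewrite lexx|apply: le_trans (cn_ge0 _)].
have := @mvi (fun t => v t - (t - a)%:C * v' a) (fun t => v' t - v' a) a b (m * (b - a)) ab.
rewrite subrr rmorph0 mul0r subr0 -mulrA -expr2 addrAC; apply=> t tab.
have [d1 d2 d3] := dv _ tab; split; first exact: cder_const_lin.
move: tab => /andP[at_ tb]; apply: le_trans (_ : m * (t - a) <= _).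
  apply: (@mvi v' v'') => // s /andP[as_ st].
  by have [|] := dv s; rewrite ?as_ ?(le_trans st).
by rewrite ler_wpM2l // lerD2r.
Qed.

(** * Distance to a linear space of functions and its propagation in time *)

Section Approx.
Variables (P : (V -> C) -> Prop) (K : set V).
Hypothesis P0 : P (fun=> 0).
Hypothesis PD : forall c p q, P p -> P q -> P (fun z => c * p z + q z).

(** The uniform distance on K from [phi] to P is at most rho; for rho = 0 this is membership in the
    closure of P. *)
Definition approx phi (rho : R) := forall e, 0 < e ->
  exists2 p, P p & forall z, K z -> cn (phi z - p z) <= rho + e.

Lemma approx_triv phi (rho : R) : (forall z, K z -> cn (phi z) <= rho) -> approx phi rho.
Proof.
move=> h e e0; exists (fun=> 0) => // z /h; rewrite subr0 => /le_trans; apply.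
by rewrite lerDl ltW.
Qed.

Lemma approx_le phi (r s : R) : approx phi r -> r <= s -> approx phi s.
Proof.
by move=> h rs e /h[p Pp hp]; exists p => // z /hp/le_trans; apply; rewrite lerD2r.
Qed.

Lemma approx_lim phi (r : R) : (forall e, 0 < e -> approx phi (r + e)) -> approx phi r.
Proof.
move=> h e e0; have e20 : 0 < e / 2 by rewrite divr_gt0.
by have [p Pp hp] := h _ e20 _ e20; exists p => // z /hp; rewrite -addrA -splitr.
Qed.

Lemma approx_add phi psi c (r s : R) : approx phi r -> approx psi s ->
  approx (fun z => c * phi z + psi z) (cn c * r + s).
Proof.
move=> h h' e e0; have e20 : 0 < e / 2 by rewrite divr_gt0.
have c1 : 0 < cn c + 1 by rewrite ltr_wpDl ?cn_ge0.
have [|p Pp hp] := h (e / 2 / (cn c + 1)); first by rewrite divr_gt0.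
have [q Pq hq] := h' _ e20; exists (fun z => c * p z + q z); first exact: PD.
move=> z Kz; have := hp _ Kz; have := hq _ Kz => h1 h2.
have -> : c * phi z + psi z - (c * p z + q z) = c * (phi z - p z) + (psi z - q z) by ring.
apply: le_trans (cnD _ _) _; rewrite cnM.
have h3 := ler_wpM2l (cn_ge0 c) h2.
have h4 : cn c * (e / 2 / (cn c + 1)) <= e / 2.
  by rewrite mulrCA ler_piMr ?(ltW e20) // ler_pdivrMr // mul1r lerDl.
rewrite mulrDr in h3; lra.
Qed.

Lemma approx_close phi psi (r s : R) : approx phi r ->
  (forall z, K z -> cn (psi z - phi z) <= s) -> approx psi (s + r).
Proof.
move=> h hs e /h[p Pp hp]; exists p => // z Kz.
by rewrite (le_trans (cn_sub_le _ _ (phi z))) // -addrA lerD ?hs ?hp.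
Qed.

(** A lower Riemann sum estimate: the rectangle s^k t lies below the increment of the primitive of
    x^k. *)
Lemma pow_convex (s t : R) k : 0 <= s -> 0 <= t ->
  s ^+ k.+1 + k.+1%:R * s ^+ k * t <= (s + t) ^+ k.+1.
Proof.
move=> s0 t0; elim: k => [|k IH]; first by rewrite !expr1 expr0; lra.
rewrite (exprS (s + t)); apply: le_trans (ler_wpM2l _ IH); last by rewrite addr_ge0.
have : 0 <= k.+1%:R * s ^+ k * t * t by rewrite !mulr_ge0 ?exprn_ge0 // ler0n.
have -> : k.+2%:R = k.+1%:R + 1 :> R by rewrite natr1.
rewrite (exprS s k.+1) (exprS s k).
set a := s ^+ k; set b := (k.+1%:R : R); nra.
Qed.

(* If the distances [d_k] of the derivatives [u_k] to the approximable
   functions vanish at time 0, then [d_k(t)] is at most the integral of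
   [d_(k+1)], hence [d_0(t) <= sup |u_j| t ^ j / j!] for every [j]. *)
Lemma analytic_continuation (u : nat -> R -> V -> C) (h M A : R) :
  (forall k t z, 0 <= t <= h -> K z -> cn (u k t z) <= M * A ^+ k * k`!%:R) ->
  (forall k t z, 0 <= t <= h -> K z -> cder (fun s => u k s z) t (u k.+1 t z)) ->
  (forall k, approx (u k 0) 0) -> 0 <= M -> 0 <= A -> A * h <= 1 / 2 ->
  forall t, 0 <= t <= h -> approx (u 0%N t) 0.
Proof.
move=> ub ud u0 M0 A0 Ah.
pose B k := M * A ^+ k * k`!%:R.
have B0 k : 0 <= B k by rewrite !mulr_ge0 ?exprn_ge0 // ler0n.
have main j : forall k t, 0 <= t <= h -> approx (u k t) (B (k + j)%N * t ^+ j / j`!%:R).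
  elim: j => [|j IH] k t th.
    by apply: approx_triv => z Kz; rewrite addn0 expr0 fact0 divr1 mulr1; exact: ub.
  move: (th) => /andP[t0 th']; set BB := B (k + j.+1)%N.
  apply: approx_lim => e e0; pose C2 := B k.+2.
  (* N Euler steps of length t / N accumulate the Taylor error N C2 (t / N)^2 = C2 t^2 / N, at most
     e for this m. *)
  have [m hm] := ex_nat_gt (C2 * t ^+ 2 / e).
  pose N := m.+1; have N0 : 0 < N%:R :> R by rewrite ltr0n.
  pose tau := t / N%:R; have tau0 : 0 <= tau by rewrite divr_ge0 // ler0n.
  have jf : 0 < j`!%:R :> R by rewrite ltr0n fact_gt0.
  have jf1 : 0 < j.+1`!%:R :> R by rewrite ltr0n fact_gt0.
  have step i : (i <= N)%N -> approx (u k (i%:R * tau))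
      (BB * (i%:R * tau) ^+ j.+1 / j.+1`!%:R + i%:R * (C2 * tau ^+ 2)).
    elim: i => [|i IHi] iN.
      by rewrite !mul0r expr0n /= mulr0 mul0r addr0; exact: u0.
    have {IHi}IHi := IHi (ltnW iN); set s := i%:R * tau in IHi *.
    have s0 : 0 <= s by rewrite mulr_ge0 // ler0n.
    have sE : i.+1%:R * tau = s + tau by rewrite /s -natr1; ring.
    have sh : s + tau <= t.
      by rewrite -sE /tau mulrCA ler_piMr // ler_pdivrMr // mul1r ler_nat.
    have sh' : 0 <= s <= h by apply/andP; split; lra.
    have hA := approx_add (tau%:C) (IH k.+1 s sh') IHi.
    have hC : forall z, K z -> cn (u k (s + tau) z -
        (tau%:C * u k.+1 s z + u k s z)) <= C2 * tau ^+ 2.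
      move=> z Kz; have := @taylor2 (fun t => u k t z) (fun t => u k.+1 t z)
        (fun t => u k.+2 t z) s (s + tau) C2.
      rewrite [s + tau - s]addrAC subrr add0r opprD addrA addrAC; apply; first lra.
      move=> r /andP[r1 r2]; have rh : 0 <= r <= h by apply/andP; split; lra.
      by split; [exact: ud|exact: ud|exact: ub].
    have {hA hC}hA := approx_close hA hC.
    rewrite sE; apply: approx_le hA _; rewrite cnr ger0_norm // addSnnS -/BB.
    have pc := pow_convex j s0 tau0.
    have : BB * (s ^+ j.+1 + j.+1%:R * s ^+ j * tau) / j.+1`!%:R <=
           BB * (s + tau) ^+ j.+1 / j.+1`!%:R.
      by rewrite ler_pM2r ?invr_gt0 // ler_wpM2l ?B0.
    have -> : BB * (s ^+ j.+1 + j.+1%:R * s ^+ j * tau) / j.+1`!%:R =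
       BB * s ^+ j.+1 / j.+1`!%:R + tau * (BB * s ^+ j / j`!%:R).
      by rewrite factS natrM; field; rewrite !gt_eqF.
    rewrite -natr1; lra.
  have := step N (leqnn N); have -> : N%:R * tau = t.
    by rewrite /tau mulrC divfK // gt_eqF.
  move=> hN; apply: approx_le hN _; rewrite lerD2l.
  have -> : N%:R * (C2 * tau ^+ 2) = C2 * t ^+ 2 / N%:R.
    by rewrite /tau; field; rewrite gt_eqF.
  rewrite ler_pdivrMr // [leRHS]mulrC -ler_pdivrMr //; apply: le_trans (ltW hm) _.
  by rewrite ler_nat.
move=> t th; move: (th) => /andP[t0 th']; apply: approx_lim => e e0.
(* As A t <= 1 / 2, the bound M (A t)^j is at most M / 2^j, below e because 2^j >= j > M / e. *)
have [j hj] := ex_nat_gt (M / e).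
have hj2 : j%:R <= 2 ^+ j :> R by rewrite -natrX ler_nat ltnW // ltn_expl.
apply: approx_le (main j 0%N t th) _; rewrite add0r add0n /B.
have jf : 0 < j`!%:R :> R by rewrite ltr0n fact_gt0.
have -> : M * A ^+ j * j`!%:R * t ^+ j / j`!%:R = M * (A * t) ^+ j.
  by rewrite exprMn; field; rewrite gt_eqF.
apply: le_trans (_ : M * (1 / 2) ^+ j <= _).
  rewrite ler_wpM2l // lerXn2r ?nnegrE ?mulr_ge0 //.
  by apply: le_trans Ah; rewrite ler_wpM2l.
rewrite expr_div_n expr1n mul1r ler_pdivrMr ?exprn_gt0 // [leRHS]mulrC -ler_pdivrMr //.
exact: le_trans (ltW hj) hj2.
Qed.

End Approx.
End Continuation.

(** * Polynomial approximation on balls *)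

Section Topology.
Variables (R : realType) (n : nat).
Local Notation C := (Cplx R).
Local Notation V := 'rV[C]_n.
Implicit Types (z u v w : V) (f g p q phi psi : V -> C) (t s h : R).

Lemma gt0_complexE (e : C) : 0 < e -> exists2 e' : R, 0 < e' & e = e'%:C.
Proof.
move=> e0; have eE : e = (complex.Re e)%:C by move/gtr0_real/RRe_real: (e0) => ->.
by exists (complex.Re e) => //; rewrite -ltcR -eE.
Qed.

(** The sup norm is at most [nv], and [nv] at most n times the sup norm; dividing by n.+1 covers n =
    0 and keeps the inequality strict. *)
Lemma nv_nbhs z (A : set V) :
  nbhs z A <-> exists2 e : R, 0 < e & forall u, nv u < e -> A (z + u).
Proof.
split=> [/nbhs_ballP[e /= /gt0_complexE[e' e0 ->] eA]|[e e0 eA]].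
  exists e' => // u ue; apply: eA; split; first by rewrite ltcR.
  move=> i j; apply/cn_ballE; rewrite mxE opprD addrA subrr add0r cnN (ord1 i).
  by apply: le_lt_trans ue; exact: cn_le_nv.
have n1 : 0 < n.+1%:R :> R by rewrite ltr0n.
apply/nbhs_ballP; exists ((e / n.+1%:R)%:C : C) => /=; first by rewrite ltcR divr_gt0.
move=> w [_ zw]; rewrite -(subrKC z w); apply: eA.
apply: le_lt_trans (_ : n%:R * (e / n.+1%:R) < e).
  have -> : n%:R * (e / n.+1%:R) = \sum_(i < n) (e / n.+1%:R).
    by rewrite sumr_const card_ord mulr_natl.
  apply: ler_sum => i _.
  have /cn_ballE := zw 0 i; rewrite cnB => /ltW; apply: le_trans.
  by rewrite !mxE.
rewrite mulrCA gtr_pMr // ltr_pdivrMr // mul1r ltr_nat //.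
Qed.

Lemma open_nopen (Om : set V) : open Om -> nopen Om.
Proof. by move=> oOm z Oz; apply/nv_nbhs; move: oOm; rewrite openE; apply. Qed.

Lemma nopen_ball (r : R) : nopen [set z : V | nv z < r].
Proof.
move=> z /= zr; exists (r - nv z) => [|u]; first by rewrite subr_gt0.
by rewrite /= ltrBrDl => /le_lt_trans; apply; exact: nvD.
Qed.

Lemma compact_polydisc (r : R) : compact [set z : V | forall i, cn (z 0 i) <= r].
Proof. exact: (@rV_compact C n (fun=> [set x | cn x <= r])) (fun=> @compact_cn R r). Qed.

(** The near-covering form of compactness, with [\oo] on the candidate bounds: near each point every
    large m is a bound, so one m serves all of K. *)
Lemma bounded_on_compact (K : set V) f : compact K ->
  (forall z, K z -> exists r M : R, 0 < r /\ forall u, nv u < r -> cn (f (z + u)) <= M) ->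
  exists M : R, forall z, K z -> cn (f z) <= M.
Proof.
move=> /compact_near_coveringP cK fK.
have [|m _ hm] := cK nat \oo (fun m z => cn (f z) <= m%:R) _ _.
  move=> z /fK[r [M [r0 fM]]]; have [m hm] := ex_nat_gt M.
  exists ([set w | nv (w - z) < r], [set k | (m <= k)%N]) => /=.
    split; last by exists m.
    by apply/nv_nbhs; exists r => // u ur /=; rewrite addrC addKr.
  move=> [w k] /= [wr mk]; rewrite -(subrKC z w); apply: le_trans (fM _ wr) _.
  by apply: le_trans (ltW hm) _; rewrite ler_nat.
by exists m%:R => z Kz; apply: (hm m) => //=.
Qed.

Lemma qdiff_bounded_ball f (r s : R) : r < s -> (forall z, nv z < s -> qdiff f z) ->
  exists M : R, forall z, nv z <= r -> cn (f z) <= M.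
Proof.
move=> rs df; have cK := @compact_polydisc r.
have cB : closed [set z : V | nv z <= r].
  move=> z zcl /=; apply/ler_addgt0Pr => e e0.
  have /zcl[w [/= wr wz]] : nbhs z [set w | nv (z - w) < e].
    by apply/nv_nbhs; exists e => // u; rewrite /= opprD addrA subrr add0r nvN.
  by rewrite -(subrK w z) addrC (le_trans (nvD _ _)) // lerD // ltW.
have cK' : compact [set z : V | nv z <= r].
  apply: subclosed_compact cB cK _ => z /= zr i; exact: le_trans (cn_le_nv _ _) zr.
apply: (bounded_on_compact cK') => z /= zr; apply: isE_locally_bounded.
by apply/isQE/DP/df; apply: le_lt_trans rs.
Qed.

Import (canonicals) mpoly.

Definition isPoly p := exists q : mpoly.mpoly n C, forall z, p z = mpoly.meval (z 0) q.

Lemma isPoly_cst c : isPoly (fun=> c).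
Proof. by exists (mpoly.mpolyC n c) => z; rewrite mpoly.mevalC. Qed.

Lemma isPoly_coord i : isPoly (fun z => z 0 i).
Proof. by exists (mpoly.mpolyX C (mpoly.mnm1 i)) => z; rewrite mpoly.mevalXU. Qed.

Lemma isPolyM p q : isPoly p -> isPoly q -> isPoly (fun z => p z * q z).
Proof.
by move=> [p' hp] [q' hq]; exists (p' * q') => z; rewrite mpoly.mevalM hp hq.
Qed.

Lemma isPolyD c p q : isPoly p -> isPoly q -> isPoly (fun z => c * p z + q z).
Proof.
move=> [p' hp] [q' hq]; exists (c *: p' + q') => z.
by rewrite mpoly.mevalD mpoly.mevalZ hp hq.
Qed.

Lemma isPolyX p k : isPoly p -> isPoly (fun z => p z ^+ k).
Proof.
move=> hp; elim: k => [|k IH]; first exact: isPoly_cst.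
rewrite (_ : (fun z => _) = (fun z => p z * p z ^+ k)); first exact: isPolyM.
by apply/funext => z; rewrite exprS.
Qed.

Lemma approxM (K : set V) phi p (B : R) : isPoly p -> (forall z, K z -> cn (p z) <= B) ->
  approx isPoly K phi 0 -> approx isPoly K (fun z => p z * phi z) 0.
Proof.
move=> hp pB hphi e e0; have B1 : 0 < `|B| + 1 by rewrite ltr_wpDl.
have [|q hq qe] := hphi (e / (`|B| + 1)); first by rewrite divr_gt0.
exists (fun z => p z * q z) => [|z Kz]; first exact: isPolyM.
rewrite -mulrBr cnM; have := qe _ Kz; rewrite !add0r => h.
apply: le_trans (_ : (`|B| + 1) * (e / (`|B| + 1)) <= _); last first.
  by rewrite mulrC divfK ?gt_eqF.
rewrite ler_pM ?cn_ge0 // (le_trans (pB _ Kz)) // (le_trans (ler_norm _)) // lerDl //.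
Qed.

Lemma cderM (v : R -> C) t l c : cder v t l -> cder (fun t => c * v t) t (c * l).
Proof.
move=> dv e e0; have c1 : 0 < cn c + 1 by rewrite ltr_wpDl ?cn_ge0.
have [|d d0 hd] := dv (e / (cn c + 1)); first by rewrite divr_gt0.
exists d => // h /hd hh.
have -> : c * v (t + h) - c * v t - h%:C * (c * l) = c * (v (t + h) - v t - h%:C * l) by ring.
rewrite cnM; apply: le_trans (ler_wpM2l (cn_ge0 _) hh) _.
rewrite mulrA ler_wpM2r // mulrCA ler_piMr ?(ltW e0) // ler_pdivrMr // mul1r lerDl //.
Qed.

Lemma nder_line z w t : nder (fun t => z + (t%:C : C) *: w) t w.
Proof.
move=> e e0; exists 1 => // h _.
rewrite rmorphD scalerDl (_ : _ - _ = 0) ?nv0 ?mulr_ge0 ?(ltW e0) //.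
by apply/rowP => i; rewrite !mxE; ring.
Qed.

Definition cut (j : nat) z : V := \row_i (if (i < j)%N then z 0 i else 0).

Lemma nv_cut_line j (i0 : 'I_n) z (t : R) : val i0 = j -> 0 <= t <= 1 ->
  nv (cut j z + (t%:C : C) *: (z 0 i0 *: delta_mx 0 i0)) <= nv z.
Proof.
move=> ij /andP[t0 t1]; apply: ler_sum => i _; rewrite !mxE eqxx /=.
case: (ltnP i j) => [lij|_].
  have -> : (i == i0) = false by apply/eqP => e; rewrite e ij ltnn in lij.
  by rewrite !mulr0 addr0.
rewrite add0r; case: (eqVneq i i0) => [->|_]; last by rewrite !mulr0 cn0 cn_ge0.
by rewrite mulr1 cnM cnr ger0_norm // ler_piMl ?cn_ge0.
Qed.

Lemma cutS j (i0 : 'I_n) z : val i0 = j ->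
  cut j z + (1%:C : C) *: (z 0 i0 *: delta_mx 0 i0) = cut j.+1 z.
Proof.
move=> ij; rewrite scale1r; apply/rowP => i; rewrite !mxE eqxx -ij /= ltnS -(val_eqE i i0) /=.
by case: (ltngtP i i0) => [||/val_inj->]; rewrite ?mulr0 ?addr0 // add0r mulr1.
Qed.

Lemma nv_delta (i : 'I_n) : nv (delta_mx 0 i : V) <= 1.
Proof.
rewrite /nv (bigD1 i) //= big1 => [|k ki]; first by rewrite mxE !eqxx cn1 addr0.
by rewrite mxE (negbTE ki) andbF cn0.
Qed.

(* Power series expansion in the first [j] variables, one variable at a time;
   the coefficients are derivatives, which again satisfy the hypothesis. *)
Theorem poly_approx (rho s : R) f : 0 < rho -> rho + 16 * expR 1 * rho < s ->
  (forall z, nv z < s -> qdiff f z) -> approx isPoly [set z | nv z <= rho] f 0.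
Proof.
move=> rho0 rs; have E0 := expR_gt0 (1 : R).
(* With this r the rate A below is 8 e rho / r = 1 / 2, so a single application of
   [analytic_continuation] covers [0, 1]. *)
pose r := 16 * expR 1 * rho; have r0 : 0 < r by rewrite !mulr_gt0.
have oB := nopen_ball (r := s).
suff H j : (j <= n)%N -> forall f, (forall z, nv z < s -> qdiff f z) ->
    approx isPoly [set z | nv z <= rho] (fun z => f (cut j z)) 0.
  move=> df; have := H n (leqnn n) f df.
  rewrite (_ : (fun z => _) = f) //; apply/funext => z; congr f.
  by apply/rowP => i; rewrite mxE ltn_ord.
elim: j => [|j IH] jn {}f df.
  move=> e e0; exists (fun=> f 0); first exact: isPoly_cst.
  move=> z _; rewrite (_ : cut 0 z = 0) ?subrr ?cn0 ?add0r ?ltW //.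
  by apply/rowP => i; rewrite !mxE.
pose i0 := Ordinal jn; pose e : V := delta_mx 0 i0.
pose g k := iter k (Lie (fun=> e)) f.
have dg k z : nv z < s -> qdiff (g k) z.
  elim: k z => [|k IHk] z zs; first exact: df.
  rewrite /g iterS; apply: (qdiff_Lie oB) => //.
  by move=> w i _; exact: qdiff_cst.
have [M fM] := qdiff_bounded_ball rs df.
have M0 : 0 <= M by apply: le_trans (cn_ge0 _) (fM 0 _); rewrite nv0 addr_ge0 ?(ltW rho0) ?(ltW r0).
pose pt z t := cut j z + (t%:C : C) *: (z 0 i0 *: e).
have ptr z t : nv z <= rho -> 0 <= t <= 1 -> nv (pt z t) <= rho.
  by move=> zr t01; apply: le_trans zr; exact: nv_cut_line.
(* The k-th time derivative of f along the segment. At t = 0 it is a monomial times a function of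
   the first j coordinates, within reach of the induction hypothesis. *)
pose u k t z := z 0 i0 ^+ k * g k (pt z t).
suff : approx isPoly [set z | nv z <= rho] (u 0%N 1) 0.
  rewrite (_ : u 0%N 1 = (fun z => f (cut j.+1 z))) //.
  by apply/funext => z; rewrite /u expr0 mul1r /pt (@cutS j i0 z erefl).
pose A := rho * (8 * expR 1 * 1 / r).
have A0 : 0 <= A.
  by apply: mulr_ge0; [exact: ltW|apply: divr_ge0; [rewrite !mulr_ge0 ?(ltW E0)|exact: ltW]].
apply: (@analytic_continuation R n isPoly [set z | nv z <= rho] (isPoly_cst 0) isPolyD u 1 M A).
- move=> k t z t01 /= zr; rewrite /u cnM cnX.
  have := @Lie_iter_bound R n (fun=> e) f (pt z t) r M 1 r0 ler01.
  have pr v : nv v < r -> nv (pt z t + v) < rho + r.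
    by move=> vr; apply: le_lt_trans (nvD _ _) _; have := ptr _ _ zr t01; lra.
  move=> /(_ _ _ _ k) h.
  apply: le_trans (ler_wpM2l _ (h _ _ _)) _; first by rewrite exprn_ge0 ?cn_ge0.
  + by move=> k' v /pr vr; apply: dg; apply: lt_trans vr _.
  + by move=> v /pr/ltW; exact: fM.
  + by move=> v _; exact: nv_delta.
  have X0 : 0 <= (8 * expR 1 * 1 / r) ^+ k.
    by apply: exprn_ge0; apply: divr_ge0; [rewrite !mulr_ge0 ?(ltW E0)|exact: ltW].
  have -> : A ^+ k = rho ^+ k * (8 * expR 1 * 1 / r) ^+ k by rewrite -exprMn.
  set X := (8 * expR 1 * 1 / r) ^+ k in X0 *.
  have -> : M * (rho ^+ k * X) * k`!%:R = rho ^+ k * (M * X * k`!%:R) by ring.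
  rewrite ler_wpM2r ?mulr_ge0 ?ler0n //.
  by rewrite lerXn2r ?nnegrE ?cn_ge0 ?(ltW rho0) // (le_trans (cn_le_nv _ _)).
- move=> k t z t01 /= zr; rewrite /u exprSr -mulrA.
  apply: (@cderM (fun s => g k (pt z s))).
  have -> : z 0 i0 * g k.+1 (pt z t) = D (g k) (pt z t) (z 0 i0 *: e).
    by rewrite (linZ _ _ (@D_lin R n _ _)) /g iterS LieE.
  apply: (@nder_comp R n (g k) (pt z)); first exact: nder_line.
  apply: dg; apply: le_lt_trans (ptr _ _ zr t01) _.
  by apply: le_lt_trans rs; rewrite lerDl ltW.
- move=> k; rewrite /u (_ : (fun z => _) = (fun z => z 0 i0 ^+ k * g k (cut j z))).
    apply: (@approxM _ _ _ (rho ^+ k)).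
    + by apply: isPolyX; exact: isPoly_coord.
    + move=> z /= zr; rewrite cnX lerXn2r ?nnegrE ?cn_ge0 ?(ltW rho0) //.
      exact: le_trans (cn_le_nv _ _) zr.
    + by apply: IH; [exact: ltnW|exact: dg].
  by apply/funext => z; rewrite /pt scale0r addr0.
- exact: M0.
- exact: A0.
- rewrite mulr1 /A /r le_eqVlt; apply/orP; left; apply/eqP; field.
  by rewrite !gt_eqF.
- by rewrite ler01 lexx.
Qed.
End Topology.

(** * Solutions of the differential equation *)

Section Flow.
Variables (R : realType) (n : nat).
Local Notation C := (Cplx R).
Local Notation V := 'rV[C]_n.
Implicit Types (z u v w : V) (f g : V -> C) (t s h : R) (F : V -> V) (x y : R -> V).

Lemma norm_nvP w (e : R) : 0 < e -> `|w| < (e%:C : C) <-> forall i, cn (w 0 i) < e.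
Proof.
move=> e0; have -> : (`|w| < (e%:C : C)) <-> ball (0 : V) (e%:C : C) w.
  by rewrite mx_norm_ball /ball_ /= sub0r normrN.
split=> [[_ h] i|h].
  by have /cn_ballE := h 0 i; rewrite mxE sub0r cnN.
split=> [|i j]; first by rewrite ltcR.
by apply/cn_ballE; rewrite mxE sub0r cnN (ord1 i).
Qed.

Lemma norm_complexE (W : normedModType C) (w : W) : exists2 a : R, 0 <= a & `|w| = a%:C :> C.
Proof.
have wE : `|w| = (complex.Re `|w|)%:C :> C by move/ger0_real/RRe_real: (normr_ge0 w) => ->.
by exists (complex.Re `|w|) => //; have := normr_ge0 w; rewrite {1}wE ler0c.
Qed.

Lemma norm_le_nv w a : `|w| = a%:C :> C -> w != 0 -> a <= 2 * nv w.
Proof.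
move=> wa w0; have nw : 0 < nv w.
  by rewrite lt_def nv_ge0 andbT; apply: contra w0 => /eqP/nv_eq0->.
have : `|w| < ((2 * nv w)%:C : C).
  apply/norm_nvP; first by rewrite mulr_gt0.
  by move=> i; apply: le_lt_trans (cn_le_nv w i) _; lra.
by rewrite wa ltcR => /ltW.
Qed.

Lemma cn_le_norm w i a : `|w| = a%:C :> C -> 0 <= a -> cn (w 0 i) <= a.
Proof.
move=> wa a0; apply/ler_addgt0Pr => e e0; apply: ltW.
have : `|w| < ((a + e)%:C : C) by rewrite wa ltcR ltrDl.
by move/norm_nvP => /(_ _)->//; rewrite ltr_wpDl.
Qed.

(** Frechet differentiability rewritten with [nv] and real constants; the real number a carries the
    norm of the remainder, which takes its values in [Cplx R]. *)
Lemma diff_near (W : normedModType C) (f : V -> W) z (e : R) : differentiable f z -> 0 < e ->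
  exists2 d : R, 0 < d & forall u, nv u < d -> exists2 a : R, a <= e * nv u &
    `|f (z + u) - f z - 'd f z u| = a%:C :> C.
Proof.
move=> /diff_locally/eqaddoP df e0.
have e20 : 0 < ((e / 2)%:C : C) by rewrite ltcR divr_gt0.
have /nv_nbhs[d d0 hd] := df _ e20; exists d => // u ud.
have := hd u ud; rewrite add0r /= => hu.
have [a a0 aE] := norm_complexE (f (z + u) - f z - 'd f z u); exists a => //.
have [b b0 bE] := norm_complexE u.
have [u0|u0] := eqVneq u 0.
  move: aE; rewrite u0 addr0 subrr linear0 subrr normr0 nv0 mulr0 => aE.
  by rewrite -lecR -aE.
move: hu; rewrite bE.
have -> : (f \o shift z - (cst (f z) + 'd f z)) u = f (z + u) - f z - 'd f z u.
  by rewrite !fctE /= (addrC u) opprD addrA.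
rewrite aE -rmorphM lecR => /le_trans; apply.
rewrite (_ : e * nv u = e / 2 * (2 * nv u)); last by field.
by rewrite ler_pM2l ?divr_gt0 //; exact: norm_le_nv.
Qed.

Lemma diff_isE f z : differentiable f z -> isE f z ('d f z).
Proof.
move=> df; split; first by move=> c u v; rewrite linearP.
move=> e /(diff_near df)[d d0 hd]; exists d => // u /hd[a ae].
by rewrite cnE => /complexI ->.
Qed.

Lemma diff_coord_isE F z i : differentiable F z -> isE (fun z => F z 0 i) z (fun u => 'd F z u 0 i).
Proof.
move=> df; split; first by move=> c u v; rewrite linearP !mxE.
move=> e /(diff_near df)[d d0 hd]; exists d => // u /hd[a ae aE].
have a0 : 0 <= a by have := normr_ge0 (F (z + u) - F z - 'd F z u); rewrite aE ler0c.
by apply: le_trans ae; have := cn_le_norm i aE a0; rewrite !mxE.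
Qed.

Lemma solution_nder F z x : is_solution F z x -> forall t, nder x t (F (x t)).
Proof.
move=> [_ hx] t e e0; have e20 : 0 < e / 2 by rewrite divr_gt0.
have nF : nbhs (F (x t)) [set w | nv (w - F (x t)) < e].
  by apply/nv_nbhs; exists e => // u ue /=; rewrite addrC addKr.
have /nbhs_ballP[d /= d0 hd] := hx t _ nF.
exists d => // h hd'; have [->|h0] := eqVneq h 0.
  by rewrite addr0 subrr rmorph0 scale0r subrr nv0 normr0 mulr0.
have := hd h; rewrite -ball_normE /= sub0r normrN => /(_ hd' h0) hh.
have hC : (h%:C : C) != 0 by rewrite -cn_eq0 cnr normr_eq0.
have -> : x (t + h) - x t - (h%:C : C) *: F (x t) =
   (h%:C : C) *: ((h%:C : C)^-1 *: (x (t + h) - x t) - F (x t)).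
  by rewrite scalerBr scalerA divff // scale1r.
by rewrite nvZ cnr mulrC ler_wpM2r // ltW.
Qed.

Lemma nder_shift x T t w : nder x (T + t) w -> nder (fun s => x (T + s)) t w.
Proof. by move=> hx e /hx[d d0 hd]; exists d => // h; rewrite addrA; apply: hd. Qed.

Lemma flow_solution F z : complete_field F -> is_solution F z (fun t => flow F t z).
Proof. by move=> cF; apply: (xgetPex (fun=> z)) (cF z). Qed.

Lemma eball0_nv (r : R) z : 0 < r -> eball0 r z -> nv z <= n%:R * r.
Proof.
move=> r0; rewrite /eball0 /=.
have -> : \sum_(i < n) `|z 0 i| ^+ 2 = (\sum_(i < n) cn (z 0 i) ^+ 2)%:C :> C.
  by rewrite rmorph_sum; apply: eq_bigr => i _; rewrite rmorphXn /= -cnE.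
rewrite -rmorphXn ltcR => h.
have -> : n%:R * r = \sum_(i < n) r by rewrite sumr_const card_ord mulr_natl.
apply: ler_sum => i _; rewrite -(@ler_pXn2r _ 2%N) ?nnegrE ?cn_ge0 ?(ltW r0) //.
apply: ltW; apply: le_lt_trans h; rewrite (bigD1 i) //= lerDl.
by apply: sumr_ge0 => j _; rewrite exprn_ge0 // cn_ge0.
Qed.

Lemma nv_eball0 (r : R) z : nv z < r -> eball0 r z.
Proof.
move=> zr; rewrite /eball0 /=.
have -> : \sum_(i < n) `|z 0 i| ^+ 2 = (\sum_(i < n) cn (z 0 i) ^+ 2)%:C :> C.
  by rewrite rmorph_sum; apply: eq_bigr => i _; rewrite rmorphXn /= -cnE.
rewrite -rmorphXn ltcR; apply: le_lt_trans (_ : nv z ^+ 2 < _).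
  rewrite expr2 {1}/nv mulr_suml; apply: ler_sum => i _.
  by rewrite expr2 ler_wpM2l ?cn_ge0 // cn_le_nv.
by rewrite ltrXn2r // ?nnegrE ?nv_ge0 // (le_trans (nv_ge0 z)) // ltW.
Qed.

(** A single constant bounds f, F and the position, so that one compactness argument makes all of
    them uniform. *)
Definition good (Om : set V) f F (p : V) (r M : R) := forall u, nv u < r ->
  [/\ Om (p + u), cn (f (p + u)) <= M, nv (F (p + u)) <= M & nv (p + u) <= M].

Lemma goodS Om f F p r M v s M' : good Om f F p r M -> nv v + s <= r -> M <= M' ->
  good Om f F (p + v) s M'.
Proof.
move=> h vs MM u us; have [] := h (v + u).
  by apply: le_lt_trans (nvD _ _) _; lra.
by rewrite addrA => ? ? ? ?; split => //; apply: le_trans MM.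
Qed.

(** * Tubes around orbits and dependence on the starting point *)

Section Field.
Variables (F : V -> V) (Om : set V) (f : V -> C).
Hypothesis dF : forall z i, qdiff (fun z => F z 0 i) z.
Hypothesis oOm : nopen Om.
Hypothesis df : forall z, Om z -> qdiff f z.

Lemma field_locally_bounded z : exists r M : R, 0 < r /\
  forall u, nv u < r -> nv (F (z + u)) <= M.
Proof.
suff H (s : seq 'I_n) : exists r M : R, 0 < r /\ forall u, nv u < r ->
    \sum_(i <- s) cn (F (z + u) 0 i) <= M by exact: H.
elim: s => [|i s [r [M [r0 h]]]].
  by exists 1, 0; split => // u _; rewrite big_nil.
have [r' [M' [r0' h']]] := isE_locally_bounded (isQE (DP (dF z i))).
exists (Num.min r r'), (M' + M); rewrite lt_min r0 r0'; split => // u.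
by rewrite lt_min big_cons => /andP[/h ? /h' ?]; apply: lerD.
Qed.

Lemma good_local z : Om z -> exists r M : R, 0 < r /\ good Om f F z r M.
Proof.
move=> Oz; have [r1 r10 h1] := oOm Oz.
have [r2 [M2 [r20 h2]]] := isE_locally_bounded (isQE (DP (df Oz))).
have [r3 [M3 [r30 h3]]] := field_locally_bounded z.
pose M := `|M2| + `|M3| + (nv z + r1).
exists (Num.min r1 (Num.min r2 r3)), M; rewrite !lt_min r10 r20 r30; split=> // u.
rewrite !lt_min => /and3P[u1 u2 u3]; have z0 := nv_ge0 z.
have a2 := ler_norm M2; have a3 := ler_norm M3; have n2 := normr_ge0 M2; have n3 := normr_ge0 M3.
split; first exact: h1.
- by apply: le_trans (h2 _ u2) _; rewrite /M; lra.
- by apply: le_trans (h3 _ u3) _; rewrite /M; lra.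
- by apply: le_trans (nvD _ _) _; rewrite /M; lra.
Qed.

(** Cauchy's estimate for each of the n coordinates of F. *)
Lemma good_lipschitz p (r M : R) : 0 < r -> good Om f F p r M -> forall u, nv u <= r / 4 ->
  nv (F (p + u) - F p) <= n%:R * (32 * M / r) * nv u.
Proof.
clear oOm df; move=> r0 g u ur.
have -> : n%:R * (32 * M / r) * nv u = \sum_(i < n) (32 * M / r * nv u).
  by rewrite sumr_const card_ord -mulrA mulr_natl.
apply: ler_sum => i _; rewrite !mxE.
have h : ballq (fun z => F z 0 i) p r M.
  by move=> v /g[_ _ FM _]; split => //; apply: le_trans (cn_le_nv _ _) FM.
by have [_ /(_ ur)[]] := D_cauchy u r0 h.
Qed.

Lemma good_tube x (T : R) : (forall t, nder x t (F (x t))) -> (forall t, 0 <= t <= T -> Om (x t)) ->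
  exists r M : R, [/\ 0 < r, 0 <= M & forall t, 0 <= t <= T -> good Om f F (x t) r M].
Proof.
move=> dx Ox; have := @segment_compact R 0 T; move=> /compact_near_coveringP cK.
have [|m _ hm] := cK nat \oo (fun m t => good Om f F (x t) m.+1%:R^-1 m%:R) _ _.
  move=> t; rewrite /= in_itv /= => /Ox/good_local[r [M [r0 g]]].
  have [d d0 hd] := nder_lip (dx t); set l := nv (F (x t)) + 1 in hd.
  have l0 : 0 < l by rewrite ltr_wpDl ?nv_ge0.
  (* For k >= m this gives both M <= k and 1 / (k + 1) <= r / 2, the other half of r absorbing the
     motion from x t to x s. *)
  have [m hm] := ex_nat_gt (`|M| + 2 / r).
  pose d' := Num.min d (r / 2 / l).
  have d'0 : 0 < d' by rewrite lt_min d0 !divr_gt0.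
  exists ([set s | `|t - s| < d'], [set k | (m <= k)%N]) => /=.
    split; last by exists m.
    by apply: (@nbhsx_ballx R R).
  move=> [s k] /= [ts mk]; have ks : m%:R <= k%:R :> R by rewrite ler_nat.
  have rr : 0 <= 2 / r by rewrite divr_ge0 // ltW.
  have -> : x s = x t + (x s - x t) by rewrite addrC subrK.
  move: ts; rewrite lt_min distrC => /andP[ts1 ts2].
  have := hd _ ts1; rewrite (_ : t + (s - t) = s); last by ring.
  move=> h1; apply: goodS g _ _; last first.
    by have := ler_norm M; lra.
  have h2 : l * `|s - t| <= r / 2 by rewrite mulrC -ler_pdivlMr // ltW.
  have h3 : k.+1%:R^-1 <= r / 2.
    rewrite -[leRHS]invrK lef_pV2 ?posrE ?ltr0n ?invr_gt0 ?divr_gt0 // invf_div.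
    have : k%:R <= k.+1%:R :> R by rewrite ler_nat.
    by have := normr_ge0 M; lra.
  by apply: le_trans (lerD (le_trans h1 h2) h3) _; rewrite -splitr.
exists m.+1%:R^-1, m%:R; split; rewrite ?invr_gt0 ?ltr0n ?ler0n // => t tT.
by apply: (hm m) => //=; rewrite in_itv.
Qed.

(** The rate 2 L exceeds the Lipschitz constant L so that the surplus, at least L b > 0, absorbs the
    errors in the two derivatives. The bound [b * expR (2 * L * T) <= r] keeps y where the Lipschitz
    estimate around x holds. *)
Lemma gronwall x y (T r L b : R) : (forall t, nder x t (F (x t))) ->
  (forall t, nder y t (F (y t))) -> 0 < L ->
  (forall t u, 0 <= t <= T -> nv u <= r -> nv (F (x t + u) - F (x t)) <= L * nv u) ->
  0 < b -> b * expR (2 * L * T) <= r -> nv (y 0 - x 0) <= b ->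
  forall t, 0 <= t <= T -> nv (y t - x t) <= b * expR (2 * L * t).
Proof.
clear dF oOm df; move=> dx dy L0 lipF b0 br yx0; apply: (@real_induction R _ 0 T).
- by rewrite mulr0 expR0 mulr1.
- move=> t /andP[t0 tT] Pt; set B := b * expR (2 * L * t) in Pt.
  have tT' : 0 <= t <= T by rewrite t0 ltW.
  have B1 : b <= B by rewrite ler_peMr ?(ltW b0) // -expR0 ler_expR !mulr_ge0 // ltW.
  have Br : B <= r.
    apply: le_trans br; rewrite ler_wpM2l ?(ltW b0) // ler_expR ler_wpM2l ?(ltW tT) //.
    by rewrite mulr_ge0 // ltW.
  pose e := L * b / 2; have e0 : 0 < e by rewrite divr_gt0 ?mulr_gt0.
  have [d1 d10 h1] := dx t _ e0; have [d2 d20 h2] := dy t _ e0.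
  exists (Num.min d1 d2); first by rewrite lt_min d10 d20.
  move=> s /andP[ts]; rewrite -ltrBlDl lt_min => /andP[s1 s2].
  pose h := s - t; have h0 : 0 <= h by rewrite subr_ge0 ltW.
  have hn : `|h| = h by rewrite ger0_norm.
  have sE : t + h = s by rewrite /h; ring.
  have := h1 h; have := h2 h; rewrite hn sE => /(_ s2) g2 /(_ s1) g1.
  have lp := lipF t _ tT' (le_trans Pt Br).
  rewrite (_ : x t + (y t - x t) = y t) in lp; last by rewrite addrC subrK.
  set De := y t - x t in Pt lp.
  have -> : y s - x s = (y s - y t - (h%:C : C) *: F (y t)) - (x s - x t - (h%:C : C) *: F (x t))
     + (De + (h%:C : C) *: (F (y t) - F (x t))).
    by apply/rowP => i; rewrite /De !mxE; ring.
  have B0 : 0 < B by apply: lt_le_trans B1.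
  apply: le_trans (nvD _ _) _; apply: le_trans (lerD (nvD _ _) (nvD _ _)) _.
  rewrite nvN nvZ cnr hn.
  apply: le_trans (_ : B * (1 + 2 * L * h) <= _); last first.
    rewrite (_ : 2 * L * s = 2 * L * t + 2 * L * h); last by rewrite /h; ring.
    by rewrite expRD mulrA ler_wpM2l ?expR_ge1Dx // ltW.
  have k1 : h * nv (F (y t) - F (x t)) <= h * (L * B).
    by rewrite ler_wpM2l // (le_trans lp) // ler_wpM2l // ltW.
  have k2 : L * b * h <= L * B * h by rewrite ler_wpM2r // ler_wpM2l // ltW.
  apply: le_trans (lerD (lerD g2 g1) (lerD Pt k1)) _.
  have -> : e * h + e * h = L * b * h by rewrite /e; field.
  by rewrite (_ : B * (1 + _) = L * B * h + (B + h * (L * B))) ?lerD2r //; ring.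
- move=> t /andP[t0 tT] Pt.
  have [d1 d10 h1] := nder_lip (dx t); have [d2 d20 h2] := nder_lip (dy t).
  set l1 := nv (F (x t)) + 1 in h1; set l2 := nv (F (y t)) + 1 in h2.
  have l10 : 0 < l1 by rewrite ltr_wpDl ?nv_ge0.
  have l20 : 0 < l2 by rewrite ltr_wpDl ?nv_ge0.
  apply/ler_addgt0Pr => e e0.
  pose k := Num.min (Num.min t (e / (l1 + l2))) (Num.min (d1 / 2) (d2 / 2)).
  have l120 : 0 < l1 + l2 by apply: addr_gt0.
  have k0 : 0 < k by rewrite !lt_min t0 !divr_gt0.
  have [k1 k2 k3 k4] : [/\ k <= t, k <= e / (l1 + l2), k <= d1 / 2 & k <= d2 / 2].
    by rewrite /k !ge_min !lexx !orbT.
  have := h1 (- k); have := h2 (- k); rewrite normrN gtr0_norm // => g2 g1.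
  have {}g1 : nv (x (t - k) - x t) <= l1 * k by apply: g1; lra.
  have {}g2 : nv (y (t - k) - y t) <= l2 * k by apply: g2; lra.
  have := Pt (t - k); rewrite subr_ge0 k1 gtrBl k0 => /(_ isT) g3.
  have g4 : b * expR (2 * L * (t - k)) <= b * expR (2 * L * t).
    by rewrite ler_wpM2l ?(ltW b0) // ler_expR ler_wpM2l ?mulr_ge0 ?(ltW L0) // gerBl ltW.
  have -> : y t - x t = (y t - y (t - k)) + (y (t - k) - x (t - k)) + (x (t - k) - x t).
    by apply/rowP => i; rewrite !mxE; ring.
  apply: le_trans (nvD _ _) _; apply: le_trans (lerD (nvD _ _) (lexx _)) _.
  rewrite (nvB (y t)); have : (l1 + l2) * k <= e by rewrite mulrC -ler_pdivlMr.
  lra.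
Qed.

Lemma solution_continuity x (T r M : R) : (forall t, nder x t (F (x t))) ->
  0 < r -> 0 <= M -> (forall t, 0 <= t <= T -> good Om f F (x t) r M) ->
  exists2 k : R, 0 < k & exists2 G : R, 0 < G & forall b y, 0 < b -> b <= k ->
  (forall t, nder y t (F (y t))) -> nv (y 0 - x 0) <= b ->
  forall t, 0 <= t <= T -> nv (y t - x t) <= b * G.
Proof.
clear oOm df; move=> dx r0 M0 g; pose L := n%:R * (32 * M / r) + 1.
have L1 : 0 <= n%:R * (32 * M / r) by rewrite !mulr_ge0 ?ler0n // invr_ge0 ltW.
have L0 : 0 < L by rewrite ltr_wpDl.
exists (r / 4 / expR (2 * L * T)); first by rewrite !divr_gt0 ?expR_gt0.
exists (expR (2 * L * T)); first exact: expR_gt0.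
move=> b y b0; rewrite ler_pdivlMr ?expR_gt0 // => br dy yx t tT.
apply: le_trans (gronwall dx dy L0 _ b0 br yx tT) _.
  move=> s u sT ur; apply: le_trans (good_lipschitz r0 (g _ sT) ur) _.
  by rewrite ler_wpM2r ?nv_ge0 // lerDl.
rewrite ler_wpM2l ?(ltW b0) // ler_expR ler_wpM2l ?mulr_ge0 ?(ltW L0) //.
by case/andP: tT.
Qed.

End Field.

(** [solution_continuity] asks for b > 0, so it is used with every small b. The tube comes from
    [good_tube] with the whole space and the zero function. *)
Lemma solution_unique F x y : (forall z i, qdiff (fun z => F z 0 i) z) ->
  (forall t, nder x t (F (x t))) -> (forall t, nder y t (F (y t))) -> y 0 = x 0 ->
  forall t, 0 <= t -> y t = x t.
Proof.
move=> dF dx dy yx0 t t0.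
have oT : nopen (setT : set V) by move=> z _; exists 1.
have dc z : setT z -> qdiff (fun=> 0 : C) z by move=> _; exact: qdiff_cst.
have [r [M [r0 M0 g]]] := @good_tube F setT _ dF oT dc x t dx (fun _ _ => I).
have [k k0 [G G0 h]] := solution_continuity dF dx r0 M0 g.
apply/eqP; rewrite -subr_eq0; apply/eqP/nv_eq0/eqP; rewrite eq_le nv_ge0 andbT.
apply/ler_addgt0Pr => e e0; rewrite add0r.
pose b := Num.min k (e / G); have b0 : 0 < b by rewrite lt_min k0 divr_gt0.
have bk : b <= k by rewrite ge_min lexx.
apply: le_trans (h b y b0 bk dy _ t _) _.
- by rewrite yx0 subrr nv0 ltW.
- by rewrite t0 lexx.
- by rewrite -ler_pdivlMr // ge_min lexx orbT.
Qed.

(** [flow] chooses a solution separately for each starting point, so the semigroup law is a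
    consequence of uniqueness. *)
Lemma flow_add F z (T s : R) : (forall z i, qdiff (fun z => F z 0 i) z) -> complete_field F ->
  0 <= s -> flow F (T + s) z = flow F s (flow F T z).
Proof.
move=> dF cF; have sz := flow_solution z cF; have sT := flow_solution (flow F T z) cF.
apply: (@solution_unique F (fun s => flow F s (flow F T z)) (fun s => flow F (T + s) z) dF).
- exact: (solution_nder sT).
- by move=> t; apply: nder_shift; exact: (solution_nder sz).
- by rewrite addr0 sT.1.
Qed.

End Flow.

(** * Approximation along the flow *)

Section Runge.
Variables (R : realType) (n : nat).
Local Notation C := (Cplx R).
Local Notation V := 'rV[C]_n.
Implicit Types (z u v w : V) (f g p q : V -> C) (t s h : R).

Import (canonicals) mpoly.

Local Notation Poly := (@isPoly R n).

Lemma qdiffX f z k : qdiff f z -> qdiff (fun z => f z ^+ k) z.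
Proof.
move=> df; elim: k => [|k IH]; first exact: qdiff_cst.
rewrite (_ : (fun z => _) = (fun z => f z * f z ^+ k)); first exact: qdiffM.
by apply/funext => w; rewrite exprS.
Qed.

Lemma qdiff_prod (I : Type) (s : seq I) (G : I -> V -> C) z :
  (forall i, qdiff (G i) z) -> qdiff (fun z => \prod_(i <- s) G i z) z.
Proof.
move=> dG; elim: s => [|i s IH].
  rewrite (_ : (fun z => _) = (fun=> 1)); first exact: qdiff_cst.
  by apply/funext => w; rewrite big_nil.
rewrite (_ : (fun z => _) = (fun z => G i z * \prod_(i <- s) G i z)); first exact: qdiffM.
by apply/funext => w; rewrite big_cons.
Qed.

Lemma isPoly_qdiff p z : isPoly p -> qdiff p z.
Proof.
move=> [q pq]; rewrite (_ : p = fun z => \sum_(m <- mpoly.msupp q) mpoly.mcoeff m q *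
    \prod_(i < n) z 0 i ^+ mpoly.fun_of_multinom m i); last first.
  by apply/funext => w; rewrite pq mpoly.mevalE.
apply: qdiff_sum => m; apply: qdiffM; first exact: qdiff_cst.
by apply: qdiff_prod => i; apply: qdiffX; exact: qdiff_coord.
Qed.

Lemma approx_comp (K : set V) f (y : V -> V) :
  (forall e : R, 0 < e -> exists2 p, isPoly p & forall z, K z -> cn (f (y z) - p (y z)) <= e) ->
  (forall p, isPoly p -> approx Poly K (fun z => p (y z)) 0) ->
  approx Poly K (fun z => f (y z)) 0.
Proof.
move=> fp hp; apply: approx_lim => e /fp[p Pp pe]; rewrite add0r -[e]addr0.
exact: approx_close (hp p Pp) pe.
Qed.

Lemma cder_rev (v : R -> C) (T s : R) l : cder v (T - s) l ->
  cder (fun s => v (T - s)) s (- l).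
Proof.
move=> hv e /hv[d d0 hd]; exists d => // h hh.
have := hd (- h); rewrite normrN => /(_ hh); rewrite rmorphN mulNr mulrN.
by rewrite opprD addrA.
Qed.

Section Main.
Variables (F : V -> V) (Om : set V) (f : V -> C) (K : set V).
Hypothesis dF : forall z i, qdiff (fun z => F z 0 i) z.
Hypothesis cF : complete_field F.
Hypothesis aF : globally_attracting0 F.
Hypothesis oOm : nopen Om.
Hypothesis Om0 : Om 0.
Hypothesis invOm : positively_invariant F Om.
Hypothesis df : forall z, Om z -> qdiff f z.
Hypothesis cK : compact K.
Hypothesis KOm : K `<=` Om.

Local Notation X := (fun z t => flow F t z).
Local Notation A0 r M := (8 * expR 1 * M / r).

Lemma flow_nder z t : nder (X z) t (F (X z t)).
Proof. exact: (solution_nder (flow_solution z cF)). Qed.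

Lemma flow0 z : flow F 0 z = z.
Proof. by have [] := flow_solution z cF. Qed.

Lemma stable (e : R) : 0 < e -> exists2 d : R, 0 < d & forall z, nv z < d ->
  forall t, 0 <= t -> nv (X z t) <= e.
Proof.
move=> e0; have [_ st _] := aF; have n1 : 0 < n.+1%:R :> R by rewrite ltr0n.
have [|d d0 hd] := st (e / n.+1%:R); first by rewrite divr_gt0.
exists d => // z /nv_eball0/hd hz t /hz/eball0_nv h.
apply: le_trans (h _) _; first by rewrite divr_gt0.
by rewrite mulrCA ler_piMr ?(ltW e0) // ler_pdivrMr // mul1r ler_nat.
Qed.

Lemma attracted z (e : R) : 0 < e -> exists2 T : R, 0 <= T & nv (X z T) < e.
Proof.
move=> e0; have [_ _ /(_ z) cv] := aF.
have : nbhs (0 : V) [set w | nv w < e].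
  by apply/nv_nbhs; exists e => // u; rewrite /= add0r.
move=> /cv[M [_ hM]]; exists (Num.max 0 (M + 1)); first by rewrite le_max lexx.
by apply: hM; rewrite lt_max ltrDl ltr01 orbT.
Qed.

(** Up to time T, nearby orbits stay in a tube around the orbit of z0. After T, stability keeps them
    within rho of 0, where [2 * rho <= r0] lets the bounds on the ball of radius r0 take over. *)
Lemma good_near (rho r0 M0 : R) z0 : 0 < rho -> 2 * rho <= r0 -> good Om f F 0 r0 M0 -> K z0 ->
  exists b r M T : R, [/\ 0 < b, 0 < r & forall z, nv (z - z0) < b ->
    (forall t, 0 <= t -> good Om f F (X z t) r M) /\ (forall t, T <= t -> nv (X z t) <= rho)].
Proof.
move=> rho0 rr g0 Kz0; have [d d0 hd] := stable rho0.
have d20 : 0 < d / 2 by rewrite divr_gt0.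
(* The orbit of z0 is within d / 2 of 0 at time T, and the choice of b adds at most d / 2 for its
   neighbours, so stability applies to them from T on. *)
have [T T0 hT] := attracted z0 d20.
have Ox t : 0 <= t <= T -> Om (X z0 t).
  by move=> /andP[t0 _]; apply: invOm => //; exact: KOm.
have [r1 [M1 [r10 M10 g1]]] := good_tube dF oOm df (flow_nder z0) Ox.
have [k k0 [G G0 hG]] := solution_continuity dF (flow_nder z0) r10 M10 g1.
pose b := Num.min k (Num.min (r1 / 2 / G) (d / 2 / G)).
have b0 : 0 < b by rewrite !lt_min k0 !divr_gt0.
have [b1 b2 b3] : [/\ b <= k, b <= r1 / 2 / G & b <= d / 2 / G].
  by rewrite /b !ge_min !lexx !orbT.
pose M := `|M0| + `|M1|; have a0 := ler_norm M0; have a1 := ler_norm M1.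
have n0 := normr_ge0 M0; have n1 := normr_ge0 M1.
exists b, (Num.min (r1 / 2) rho), M, T; split=> //; first by rewrite lt_min rho0 divr_gt0.
move=> z zb.
have near_x t : 0 <= t <= T -> nv (X z t - X z0 t) <= b * G.
  by apply: (hG b (X z) b0 b1 (flow_nder z)); rewrite !flow0 ltW.
have late t : T <= t -> nv (X z t) <= rho.
  move=> Tt; rewrite (_ : t = T + (t - T)); last by ring.
  rewrite (flow_add z T dF cF) ?subr_ge0 //; apply: hd; last by rewrite subr_ge0.
  rewrite -[flow F T z](subrK (X z0 T)); apply: le_lt_trans (nvD _ _) _.
  have h1 : nv (X z T - X z0 T) <= b * G by apply: near_x; rewrite T0 lexx.
  have h2 : b * G <= d / 2 by rewrite -ler_pdivlMr.
  by rewrite [ltRHS]splitr; apply: ler_ltD => //; exact: le_trans h2.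
split => // t t0; case: (leP t T) => tT.
  have h1 : nv (X z t - X z0 t) <= b * G by apply: near_x; rewrite t0 tT.
  have h2 : b * G <= r1 / 2 by rewrite -ler_pdivlMr.
  have -> : flow F t z = X z0 t + (X z t - X z0 t) by rewrite addrC subrK.
  apply: (goodS (g1 t _)); first by rewrite t0.
    apply: le_trans (_ : r1 / 2 + r1 / 2 <= r1); last by rewrite -splitr.
    by apply: lerD; [exact: le_trans h2|rewrite ge_min lexx].
  by rewrite /M; lra.
rewrite -[flow F t z]add0r; apply: (goodS g0).
  apply: le_trans (_ : rho + rho <= r0); last by move: rr; rewrite mulr_natl.
  by apply: lerD; [exact: late (ltW tT)|rewrite ge_min lexx orbT].
by rewrite /M; lra.
Qed.

Lemma good_uniform (rho r0 M0 : R) : 0 < rho -> 2 * rho <= r0 -> good Om f F 0 r0 M0 ->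
  exists r M T : R, [/\ 0 < r, 0 < M & forall z, K z ->
    (forall t, 0 <= t -> good Om f F (X z t) r M) /\ (forall t, T <= t -> nv (X z t) <= rho)].
Proof.
move=> rho0 rr g0; have /compact_near_coveringP cov := cK.
have [|m _ hm] := cov nat \oo (fun m z =>
  (forall t, 0 <= t -> good Om f F (X z t) m.+1%:R^-1 m.+1%:R) /\
  (forall t, m.+1%:R <= t -> nv (X z t) <= rho)) _ _.
  move=> z /(good_near rho0 rr g0)[b [r [M [T [b0 r_0 hz]]]]].
  have [m hm] := ex_nat_gt (`|M| + `|T| + r^-1).
  exists ([set w | nv (w - z) < b], [set k | (m <= k)%N]) => /=.
    split; last by exists m.
    by apply/nv_nbhs; exists b => // u ub /=; rewrite addrC addKr.
  move=> [w k] /= [/hz[h1 h2] mk].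
  have ks : m%:R <= k.+1%:R :> R by rewrite ler_nat leqW.
  have nM := normr_ge0 M; have nT := normr_ge0 T; have lM := ler_norm M.
  have lT := ler_norm T; have ir : 0 < r^-1 by rewrite invr_gt0.
  split=> t tt; last by apply: h2; lra.
  rewrite -[flow F t w]addr0; apply: (goodS (h1 t tt)); last by lra.
  rewrite nv0 add0r -[leRHS]invrK lef_pV2 ?posrE ?ltr0n //; lra.
exists m.+1%:R^-1, m.+1%:R, m.+1%:R; rewrite invr_gt0 ltr0n; split => // z Kz.
by apply: (hm m) => //=.
Qed.

Lemma qdiff_iter (O : set V) g : nopen O -> (forall z, O z -> qdiff g z) ->
  forall k z, O z -> qdiff (iter k (Lie F) g) z.
Proof.
move=> oO dg; elim=> [|k IH] z Oz; first exact: dg.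
by rewrite iterS; apply: (qdiff_Lie oO IH) => // w i _; exact: dF.
Qed.

Lemma cder_iter (O : set V) g k z t : nopen O -> (forall z, O z -> qdiff g z) ->
  O (X z t) -> cder (fun s => iter k (Lie F) g (X z s)) t (iter k.+1 (Lie F) g (X z t)).
Proof.
move=> oO dg Oz; rewrite iterS LieE; apply: nder_comp; first exact: flow_nder.
exact: (qdiff_iter oO dg).
Qed.

(** * Continuation by steps of uniform length *)

Section Uniform.
Variables (r M : R).
Hypothesis r0 : 0 < r.
Hypothesis M0 : 0 < M.
Hypothesis gX : forall z, K z -> forall t, 0 <= t -> good Om f F (X z t) r M.

(** Half of 1 / A, with A the rate of growth in [Lie_iter_bound]; [analytic_continuation] requires A
    h <= 1 / 2. *)
Definition step : R := (2 * (A0 r M))^-1.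

Lemma A0_gt0 : 0 < A0 r M.
Proof. by rewrite divr_gt0 // !mulr_gt0 // expR_gt0. Qed.

Lemma step_gt0 : 0 < step.
Proof. by rewrite invr_gt0 mulr_gt0 // A0_gt0. Qed.

Lemma step_bound h : h <= step -> A0 r M * h <= 1 / 2.
Proof.
move=> hs; have a0 := A0_gt0; apply: le_trans (ler_wpM2l (ltW a0) hs) _.
by rewrite /step le_eqVlt; apply/orP; left; apply/eqP; field; rewrite !gt_eqF ?expR_gt0.
Qed.

(** The bound on g may rely on either estimate in [good]: polynomials use [nv z <= M], while f uses
    [cn (f z) <= M] with N = M. *)
Lemma iter_boundX g (N : R) k z t : (forall k z, Om z -> qdiff (iter k (Lie F) g) z) ->
  (forall z, Om z -> nv z <= M -> cn (f z) <= M -> cn (g z) <= N) -> K z -> 0 <= t ->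
  cn (iter k (Lie F) g (X z t)) <= N * (A0 r M) ^+ k * k`!%:R.
Proof.
move=> dg gN Kz t0; have h := gX Kz t0.
apply: (Lie_iter_bound r0 (ltW M0)).
- by move=> k' u /h[Ou _ _ _]; exact: dg.
- by move=> u /h[? ? ? ?]; exact: gN.
- by move=> u /h[].
Qed.

(** The Lie derivatives of q are entire, hence limits of polynomials on the ball of radius M, which
    contains the orbits. The hypothesis at time t therefore covers all time derivatives there, as
    [analytic_continuation] requires. *)
Lemma poly_flow_step t : 0 <= t -> (forall q, isPoly q -> approx Poly K (fun z => q (X z t)) 0) ->
  forall s, 0 <= s <= step -> forall q, isPoly q -> approx Poly K (fun z => q (X z (t + s))) 0.
Proof.
move=> t0 ht s ss q hq.
have oT : nopen (setT : set V) by move=> z _; exists 1.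
have dq k z : qdiff (iter k (Lie F) q) z.
  by apply: (qdiff_iter oT) => // w _; exact: isPoly_qdiff.
have M1 : M < M + 1 by rewrite ltrDl.
have [N qN] := qdiff_bounded_ball M1 (fun z _ => isPoly_qdiff z hq).
have N0 : 0 <= N by apply: le_trans (cn_ge0 _) (qN 0 _); rewrite nv0 ltW.
pose u k s z := iter k (Lie F) q (X z (t + s)).
change (approx Poly K (u 0%N s) 0).
apply: (@analytic_continuation R n Poly K (@isPoly_cst R n 0) (@isPolyD R n)
  u step N (A0 r M)) => //.
- move=> k t' z /andP[t'0 _] Kz; apply: iter_boundX => //; last exact: addr_ge0.
  by move=> w _ wM _; exact: qN.
- move=> k t' z /andP[t'0 _] Kz.
  have := @cder_iter setT q k z (t + t') oT (fun w _ => isPoly_qdiff w hq) I.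
  by move=> h e /h[d d0 hd]; exists d => // h'; rewrite /u addrA; exact: hd.
- move=> k; rewrite /u addr0; apply: (@approx_comp _ _ (fun z => X z t)) => // e e0.
  have [|p hp pe] := @poly_approx R n M (M + 16 * expR 1 * M + 1) (iter k (Lie F) q) M0 _
    (fun z _ => dq k z) e e0; first by rewrite ltrDl.
  exists p => // z Kz; rewrite -[leRHS]add0r; apply: pe => /=.
  by have [|_ _ _] := gX Kz t0 (u := 0); rewrite ?nv0 ?addr0.
- exact: ltW A0_gt0.
- exact: step_bound.
Qed.

Lemma poly_flow t q : 0 <= t -> isPoly q -> approx Poly K (fun z => q (X z t)) 0.
Proof.
move=> t0 hq; have s0 := step_gt0.
have [N hN] := ex_nat_gt (t / step); rewrite ltr_pdivrMr // in hN.
elim: N t t0 {hN}(ltW hN) q hq => [|N IH] t t0 tN q hq.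
  have -> : t = 0 by apply/eqP; rewrite eq_le t0 andbT -(mul0r step).
  by move=> e e0; exists q => // z _; rewrite flow0 subrr cn0 add0r ltW.
have [tN'|Nt] := leP t (N%:R * step); first exact: IH.
have Ns : 0 <= N%:R * step by rewrite mulr_ge0 ?ler0n ?(ltW s0).
rewrite (_ : t = N%:R * step + (t - N%:R * step)); last by ring.
apply: poly_flow_step => //; first by move=> p hp; exact: IH.
rewrite subr_ge0 (ltW Nt) lerBlDl; apply: le_trans tN _.
by rewrite -natr1 mulrDl mul1r.
Qed.

Definition approx_from (T : R) := forall t, T <= t -> approx Poly K (fun z => f (X z t)) 0.

Lemma approx0Z c (phi : V -> C) : approx Poly K phi 0 -> approx Poly K (fun z => c * phi z) 0.
Proof.
move=> h; have h0 : approx Poly K (fun=> 0) 0.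
  by apply: approx_triv => [|z _]; rewrite ?cn0 //; exact: isPoly_cst.
have := approx_add (@isPolyD R n) c h h0; rewrite mulr0 addr0.
by congr (approx _ _ _ _); apply/funext => z; rewrite addr0.
Qed.

Lemma f_boundX k z t : K z -> 0 <= t ->
  cn (iter k (Lie F) f (X z t)) <= M * (A0 r M) ^+ k * k`!%:R.
Proof.
move=> Kz t0; apply: (@iter_boundX f M k z t _ _ Kz t0) => //.
by move=> k' w; exact: (qdiff_iter oOm df).
Qed.

Lemma OmX z t : K z -> 0 <= t -> Om (X z t).
Proof.
by move=> Kz t0; have [|+ _ _ _] := gX Kz t0 (u := 0); rewrite ?nv0 ?addr0.
Qed.

(* The Lie derivatives of [f] along the flow are uniform limits on [K] of
   difference quotients into the future. *)
Lemma approx_iter (T : R) : 0 <= T -> approx_from T -> forall k t, T <= t ->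
  approx Poly K (fun z => iter k (Lie F) f (X z t)) 0.
Proof.
move=> T0 hT; elim=> [|k IH] t Tt; first exact: hT.
have t0 : 0 <= t := le_trans T0 Tt.
pose B := M * (A0 r M) ^+ k.+2 * k.+2`!%:R.
have B0 : 0 <= B.
  apply: mulr_ge0; last exact: ler0n.
  by apply: mulr_ge0; [exact: ltW|apply: exprn_ge0; exact: ltW A0_gt0].
have B1 : 0 < B + 1 by rewrite ltr_wpDl.
apply: approx_lim => e e0; rewrite add0r -[e]addr0.
(* The Taylor error of the difference quotient is B h, at most e. *)
pose h := e / (B + 1); have h0 : 0 < h by rewrite divr_gt0.
have th : t <= t + h by rewrite lerDl ltW.
have h1 := approx0Z (- h%:C^-1) (IH t Tt).
have := approx_add (@isPolyD R n) (h%:C^-1) (IH (t + h) (le_trans Tt th)) h1.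
rewrite (_ : cn _ * 0 + 0 = 0) => [h2|]; last by rewrite mulr0 addr0.
apply: (approx_close h2) => z Kz.
have hC : (h%:C : C) != 0 by rewrite -cn_eq0 cnr normr_eq0 gt_eqF.
have := @taylor2 R (fun s => iter k (Lie F) f (X z s)) (fun s => iter k.+1 (Lie F) f (X z s))
  (fun s => iter k.+2 (Lie F) f (X z s)) t (t + h) B th.
rewrite (_ : t + h - t = h); last by ring.
move=> /(_ _) h3; have {}h3 := h3 _.
set a := iter k (Lie F) f (flow F (t + h) z) in h3 *.
set b := iter k (Lie F) f (flow F t z) in h3 *.
set c := iter k.+1 (Lie F) f (flow F t z) in h3 *.
have -> : c - (h%:C^-1 * a + - h%:C^-1 * b) = - (h%:C^-1 * (a - b - h%:C * c)).
  by field.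
rewrite cnN cnM cnV cnr gtr0_norm //.
apply: le_trans (_ : h^-1 * (B * h ^+ 2) <= _).
  rewrite ler_wpM2l ?invr_ge0 ?(ltW h0) //; apply: h3 => s /andP[ts _].
  have s0 : 0 <= s := le_trans t0 ts.
  by split; [apply: (cder_iter _ oOm df); exact: OmX|apply: (cder_iter _ oOm df); exact: OmX
    |exact: f_boundX].
rewrite expr2 mulrCA mulKf ?gt_eqF // /h mulrCA ler_piMr ?(ltW e0) //.
by rewrite ler_pdivrMr // mul1r lerDl.
Qed.

(** Continuation in the reversed time s |-> T - s, which puts the sign (-1)^k on the k-th
    derivative; T - s >= 0 keeps the orbits in the uniform tube. *)
Lemma approx_back (T h : R) : 0 <= h <= step -> h <= T -> approx_from T ->
  approx Poly K (fun z => f (X z (T - h))) 0.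
Proof.
move=> /andP[h0 hs] hT aT; have T0 : 0 <= T := le_trans h0 hT.
pose u k s z := (-1) ^+ k * iter k (Lie F) f (X z (T - s)).
have := @analytic_continuation R n Poly K (@isPoly_cst R n 0) (@isPolyD R n) u h M (A0 r M).
rewrite /u expr0 => /(_ _ _ _ (ltW M0) (ltW A0_gt0) (step_bound hs) h).
rewrite h0 lexx (_ : (fun z => 1 * _) = (fun z => f (X z (T - h)))); last first.
  by apply/funext => z; rewrite mul1r.
apply=> //.
- move=> k t z /andP[t0 th] Kz; rewrite cnM cnX cnN cn1 expr1n mul1r.
  by apply: f_boundX => //; rewrite subr_ge0 (le_trans th).
- move=> k t z /andP[t0 th] Kz.
  have -> : (-1) ^+ k.+1 * iter k.+1 (Lie F) f (X z (T - t)) =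
     (-1) ^+ k * (- iter k.+1 (Lie F) f (X z (T - t))) :> C by rewrite exprS; ring.
  apply: cderM; apply: (@cder_rev (fun s => iter k (Lie F) f (X z s))).
  by apply: (cder_iter _ oOm df); apply: OmX => //; rewrite subr_ge0 (le_trans th).
- by move=> k; apply: approx0Z; rewrite subr0; apply: approx_iter aT _ _ _.
Qed.

Lemma approx_from0 (T : R) : 0 <= T -> approx_from T -> approx_from 0.
Proof.
move=> T0 aT; have s0 := step_gt0.
(* All of [S - h, S] is recovered, and not its left end alone, because [approx_iter] differentiates
   into the future at the next stage. *)
have back (S h : R) : 0 <= h <= step -> h <= S -> approx_from S -> approx_from (S - h).
  move=> /andP[h0 hs] hS aS t St; case: (leP S t) => tS; first exact: aS.
  rewrite (_ : t = S - (S - t)); last by ring.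
  by apply: approx_back => //; [apply/andP; split; lra|lra].
have [N hN] := ex_nat_gt (T / step); rewrite ltr_pdivrMr // in hN.
elim: N T T0 aT {hN}(ltW hN) => [|N IH] T T0 aT TN.
  by have -> : 0 = T by apply/eqP; rewrite eq_le T0 -(mul0r step).
have [Ts|sT] := leP T step.
  by rewrite -(subrr T); apply: back => //; rewrite T0.
apply: (IH (T - step)).
- by rewrite subr_ge0 ltW.
- by apply: back; rewrite ?lexx ?(ltW s0) ?(ltW sT).
- by rewrite lerBlDr; apply: le_trans TN _; rewrite -natr1 mulrDl mul1r.
Qed.

End Uniform.

Theorem approx_on_compact (e : R) : 0 < e ->
  exists2 p, isPoly p & forall z, K z -> cn (f z - p z) <= e.
Proof.
move=> e0; have [r0 [M0 [r00 g0]]] := good_local dF oOm df Om0.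
have E0 := expR_gt0 (1 : R).
(* This meets the condition rho (1 + 16 e) < r0 of [poly_approx], the factor 1 / 2 making it strict,
   and also gives 2 rho <= r0. *)
pose rho := r0 / 2 / (1 + 16 * expR 1).
have E1 : 1 <= 1 + 16 * expR 1 :> R by lra.
have E2 : 0 < 1 + 16 * expR 1 :> R by lra.
have rho0 : 0 < rho by rewrite !divr_gt0.
have rr : 2 * rho <= r0.
  rewrite mulrC -ler_pdivlMr // /rho ler_pdivrMr // ler_peMr // divr_ge0 // ltW //.
have [r [M [T [r_0 M_0 hX]]]] := good_uniform rho0 rr g0.
have gX z (Kz : K z) t (t0 : 0 <= t) := (hX z Kz).1 t t0.
have aT : approx_from (Num.max 0 T).
  move=> t; rewrite ge_max => /andP[t0 Tt].
  apply: (@approx_comp _ _ (fun z => X z t)) => [d d0|p hp]; last exact: (poly_flow r_0 M_0 gX).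
  have [||p hp pe] := @poly_approx R n rho r0 f rho0 _ _ d d0.
  - rewrite (_ : rho + _ = rho * (1 + 16 * expR 1)); last by ring.
    by rewrite /rho divfK ?gt_eqF // ltr_pdivrMr // ltr_pMr // ltr1n.
  - by move=> z /g0; rewrite add0r => -[? _ _ _]; exact: df.
  exists p => // z Kz; rewrite -[leRHS]add0r; apply: pe => /=.
  exact: (hX z Kz).2.
have T0 : 0 <= Num.max 0 T by rewrite le_max lexx.
have [p hp pe] := approx_from0 r_0 M_0 gX T0 aT (lexx 0) e0.
by exists p => // z /pe; rewrite flow0 add0r.
Qed.

End Main.
End Runge.

Theorem theorem1p1 (R : realType) (n : nat)
    (F : 'rV[Cplx R]_n -> 'rV[Cplx R]_n) (Omega : set 'rV[Cplx R]_n) :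
  holomorphic_on setT F ->
  complete_field F ->
  globally_attracting0 F ->
  is_domain Omega ->
  Omega 0 ->
  positively_invariant F Omega ->
  is_runge_domain Omega.
Proof.
move=> hF cF aF dO O0 iO; split => // f hf K cK KO eps eps0.
have [_ /open_nopen oO _] := dO.
have oT : nopen (setT : set 'rV[Cplx R]_n) by move=> z _; exists 1.
have dF z i : qdiff (fun z => F z 0 i) z.
  apply: (isE_qdiff oT) => // w _; exists (fun u => 'd F w u 0 i).
  exact/diff_coord_isE/hF.
have df z : Omega z -> qdiff f z.
  by apply: (isE_qdiff oO) => w Ow; exists ('d f w); exact/diff_isE/hf.
have e20 : 0 < eps / 2 by rewrite divr_gt0.
have [p [q pq] hp] := approx_on_compact dF cF aF oO O0 iO df cK KO e20.
exists q => z /hp; rewrite pq => h; rewrite cnE ltcR; apply: le_lt_trans h _.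
by rewrite ltr_pdivrMr // ltr_pMr // ltr1n.
Qed.
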